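(* Let $0<a<1$ and let $(a_n)_{n=0}^\infty$ be a sequence of independent real random variables on a probability space $(\Omega,\mathbb{P})$, with $a_n$ uniformly distributed on $(-a^n,a^n)$. Let $(b_n)_{n=0}^\infty$ be a sequence of real numbers with $\lim_{n\to\infty} b_{n+1}/b_n = b$ for some $b>1$ satisfying $ab>1$. Let $\theta_n\in\mathbb{R}$ for $n\in\mathbb{N}$. Let $g:\mathbb{R}\to\mathbb{R}$ be a $C^1$ periodic function having only finitely many critical points in every bounded interval. Define $$f(x)=\sum_{n=0}^\infty a_n\, g(b_n x+\theta_n).$$ Then, almost surely, the Hausdorff dimension and the box dimension of the graph of $f$ are equal to $$D = 2+\frac{\log a}{\log b}.$$
   Context: The graph of $f$ is considered over one period interval $[0,T]$ of $g$, where $T$ is the period of $g$ (the paper normalizes $T=1$ and takes the graph over $[0,1]$). A critical point of $g$ is a point where $g'$ vanishes. *)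

(* Defs.v *)
From HB Require Import structures.
From mathcomp Require Import all_boot all_order all_algebra.
From mathcomp Require Import all_classical all_reals all_analysis.
Set Implicit Arguments. Unset Strict Implicit. Unset Printing Implicit Defensive.
Import Order.TTheory GRing.Theory Num.Theory.
Import numFieldNormedType.Exports.
Local Open Scope classical_set_scope.
Local Open Scope ring_scope.

Section Dimensions.
Context {R : realType}.

Definition dist2 (p q : R * R) : R :=
  Num.sqrt ((p.1 - q.1) ^+ 2 + (p.2 - q.2) ^+ 2).

Definition diam_le (U : set (R * R)) (d : R) : Prop :=
  forall p q, U p -> U q -> dist2 p q <= d.

(** delta-approximation of the s-dimensional Hausdorff measure:
    infimum of sum_i diam(U_i)^s over countable covers by sets of diameter
    at most delta (d_i bounds diam U_i; taking the infimum over such bounds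
    is the same as using the diameters themselves). *)
Definition hausdorff_content (s delta : R) (E : set (R * R)) : \bar R :=
  ereal_inf [set x | exists (U : nat -> set (R * R)) (d : nat -> R),
     [/\ E `<=` \bigcup_i U i,
         (forall i, 0 <= d i /\ d i <= delta),
         (forall i, diam_le (U i) (d i)) &
         x = (\sum_(i <oo) ((d i) `^ s)%:E)%E]].

(** s-dimensional Hausdorff measure: limit (= supremum) as delta -> 0+. *)
Definition hausdorff_measure (s : R) (E : set (R * R)) : \bar R :=
  ereal_sup [set hausdorff_content s delta E | delta in [set delta | 0 < delta]].

Definition hausdorff_dim (E : set (R * R)) : \bar R :=
  ereal_inf [set s%:E | s in [set s | 0 < s /\ hausdorff_measure s E = 0%E]].

Definition covers_by (E : set (R * R)) (delta : R) (n : nat) : Prop :=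
  exists U : nat -> set (R * R),
    E `<=` \bigcup_(i in `I_n) U i /\ forall i, (i < n)%N -> diam_le (U i) delta.

(** N_delta(E): the smallest number of sets of diameter at most delta
    covering E (infimum of a nonempty set of naturals
    is attained; the library's [inf] of the empty set is 0, which never
    occurs for bounded sets). *)
Definition box_count (E : set (R * R)) (delta : R) : R :=
  inf [set n%:R | n in [set n | covers_by E delta n]].

Definition box_dim_eq (E : set (R * R)) (D : R) : Prop :=
  (fun delta => ln (box_count E delta) / - ln delta) @ 0^'+ --> D.

Definition graph_on (h : R -> R) (u v : R) : set (R * R) :=
  [set p | u <= p.1 <= v /\ p.2 = h p.1].

End Dimensions.

Section Probability.
Context {R : realType} {d : measure_display} {Omega : measurableType d}.

Definition mutually_independent (P : probability Omega R)
    (X : nat -> Omega -> R) : Prop :=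
  forall (S : seq nat) (A : nat -> set R),
    uniq S -> (forall i, i \in S -> measurable (A i)) ->
    P (\bigcap_(i in [set i | i \in S]) (X i @^-1` A i)) =
    (\prod_(i <- S) P (X i @^-1` A i))%E.

Definition uniform_on_sym (P : probability Omega R) (X : Omega -> R) (c : R)
  : Prop :=
  forall A : set R, measurable A ->
    P (X @^-1` A) =
    (lebesgue_measure (A `&` `](- c)%R, c%R[%classic) * ((2 * c)^-1)%:E)%E.

End Probability.

(* Main.v *)
Require Import Defs.
From HB Require Import structures.
From mathcomp Require Import all_boot all_order all_algebra.
From mathcomp Require Import all_classical all_reals all_analysis.
From mathcomp Require Import measurable_realfun ring lra.
Import Order.TTheory GRing.Theory Num.Theory.
Import numFieldNormedType.Exports.
Local Open Scope classical_set_scope.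
Local Open Scope ring_scope.
Set Implicit Arguments. Unset Strict Implicit. Unset Printing Implicit Defensive.

(** Put al = - ln a / ln b, so that D = 2 - al. Almost surely |a_n| <= a^n for all
    n, which makes f Hoelder of every exponent h < al; counting squares then
    bounds both dimensions from above.

    For the lower bound fix y and r. If some increment
    c_k(x) = g(b_k x + theta_k) - g(b_k y + theta_k) exceeds delta in absolute
    value, then f(x) - f(y) has, thanks to the term a_k c_k alone, a density
    bounded by a^-k / delta, so P(|f(x) - f(y)| <= 3 r) = O(r / a^k). The x for
    which the increments 0, ..., k - 1 are all at most delta form a set of length
    O(lam^k), for any lam > 1/b provided delta is small: the level sets of g
    split into boundedly many short intervals, which are refined from scale to
    scale. This length is also at most 2 r, hence O(r^t lam^(k (1 - t))), and
    summing over k gives O(r^(1 + t)) for the integral over x as soon as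
    lam^(1 - t) < a, that is, for every t < D - 1. By Borel-Cantelli along
    r = 2^-n, for almost all omega most points x satisfy
    |{y : |x - y| <= r, |f(x) - f(y)| <= r}| <= r^s at all small dyadic scales r,
    for any s < 1 + t, and the mass distribution principle for the lift of
    Lebesgue measure to the graph shows that the s-dimensional Hausdorff measure
    of the graph is positive. *)

(** * Hausdorff contents and box counts *)

Lemma hausdorff_content_ge0 (R : realType) (s delta : R) (E : set (R * R)) :
  (0 <= hausdorff_content s delta E)%E.
Proof.
apply: le_ereal_inf_tmp => x [U [d [_ _ _ ->]]].
by apply: nneseries_ge0 => n _ _; rewrite lee_fin powR_ge0.
Qed.

(** Numbers in [0, 1] have smaller powers for larger exponents, so every admissible cover becomes
    cheaper. *)
Lemma le_hausdorff_content_exp (R : realType) (s s' delta : R)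
    (E : set (R * R)) : 0 < s -> s <= s' -> delta <= 1 ->
  (hausdorff_content s' delta E <= hausdorff_content s delta E)%E.
Proof.
move=> s0 ss' d1; apply: le_ereal_inf_tmp => _ [U [d [EU dd dU ->]]].
apply: ge_ereal_inf.
exists (\sum_(i <oo) ((d i) `^ s')%:E)%E; first by exists U, d; split.
apply: lee_nneseries => n _; first by move=> _; rewrite lee_fin powR_ge0.
rewrite lee_fin; have [d0 dn] := dd n.
(* Monotonicity in the exponent is applied to a positive base. At base 0 both powers vanish because
   both exponents are positive; 0^0 would be 1. *)
have [->|dn0] := eqVneq (d n) 0.
  by rewrite !powR0 // gt_eqF // (lt_le_trans s0).
by apply: ger_powR => //; rewrite lt_def dn0 d0 (le_trans dn).
Qed.

Lemma le_hausdorff_content_delta (R : realType) (s delta delta' : R)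
    (E : set (R * R)) : delta' <= delta ->
  (hausdorff_content s delta E <= hausdorff_content s delta' E)%E.
Proof.
move=> dd; apply: ereal_inf_le_tmp => _ [U [d [EU h1 h2 ->]]].
exists U, d; split => // i; have [? ?] := h1 i; split => //.
exact: le_trans dd.
Qed.

(** The finite cover is padded to a sequence by empty sets with diameter bound 0, which cost nothing
    because [0 < s]. *)
Lemma hausdorff_content_covers (R : realType) (s delta : R) (E : set (R * R))
    (n : nat) : 0 < s -> 0 <= delta -> covers_by E delta n ->
  (hausdorff_content s delta E <= (n%:R * delta `^ s)%:E)%E.
Proof.
move=> s0 d0 [U [EU dU]]; apply: ge_ereal_inf.
pose e := fun i => if (i < n)%N then delta else 0.
exists (\sum_(i <oo) ((e i) `^ s)%:E)%E.
  exists (fun i => if (i < n)%N then U i else set0), e; split => //.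
  - by move=> p /EU [i /= ilt Ui]; exists i => //; rewrite ilt.
  - by move=> i; rewrite /e; case: ifP; rewrite lexx.
  - by move=> i; rewrite /e; case: ifP => [/dU|_ p q []//].
rewrite (@nneseries_split _ _ 0 n) ?add0n; last first.
  by move=> k _; rewrite lee_fin powR_ge0.
rewrite [X in (_ + X)%E]eseries0 ?adde0; last first.
  by move=> i ni _; rewrite /e ltnNge ni /= powR0 // gt_eqF.
rewrite (eq_big_nat _ _ (F2 := fun=> (delta `^ s)%:E)); last first.
  by move=> i /andP[_ ilt]; rewrite /e ilt.
by rewrite sumEFin big_const_nat iter_addr_0 subn0 mulr_natl.
Qed.

(** A finite cover at a finer scale is admissible for the content. This lets one lower estimate
    serve both the Hausdorff and the box dimension. *)
Lemma content_pos_covers (R : realType) (s c delta0 delta : R)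
    (E : set (R * R)) (n : nat) : 0 < s ->
  (c%:E <= hausdorff_content s delta0 E)%E -> 0 < delta <= delta0 ->
  covers_by E delta n -> c * delta `^ (- s) <= n%:R.
Proof.
move=> s0 cE /andP[d0 dd] cov.
have := le_trans cE (le_trans (le_hausdorff_content_delta s E dd)
  (hausdorff_content_covers s0 (ltW d0) cov)).
by rewrite lee_fin powRN ler_pdivrMr ?powR_gt0.
Qed.

(** A single scale [delta0] suffices, since the content can only grow as the scale decreases. *)
Definition content_lower_bound (R : realType) (E : set (R * R)) (s : R) : Prop :=
  exists c delta0 : R,
    [/\ 0 < c, 0 < delta0 & (c%:E <= hausdorff_content s delta0 E)%E].

Definition count_upper_bound (R : realType) (E : set (R * R)) (s : R) : Prop :=
  exists C delta0 : R,
    [/\ 0 < C, 0 < delta0 & forall delta : R, 0 < delta < delta0 ->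
      exists2 n, covers_by E delta n & n%:R <= C * delta `^ (- s)].

(** If the measure of some exponent [s < D] vanished, so would the content of a larger exponent [s']
    that is bounded below. Conversely, covers counted with exponent [D + e / 2] cost O(x^(e/2)) in
    exponent [D + e], which tends to 0 with the scale x. *)
Lemma hausdorff_dim_of_bounds (R : realType) (E : set (R * R)) (D : R) : 0 < D ->
  (forall e : R, 0 < e ->
    exists s : R, [/\ D - e < s, 0 < s & content_lower_bound E s]) ->
  (forall s : R, D < s -> count_upper_bound E s) ->
  hausdorff_dim E = D%:E.
Proof.
move=> D0 lowerE upperE.
apply/eqP; rewrite eq_le; apply/andP; split; last first.
  apply: le_ereal_inf_tmp => _ [s [s0 Hs] <-]; rewrite lee_fin leNgt.
  apply/negP => sD.
  have [|s' [ss' s'0 [c [d0 [c0 d00 cE]]]]] := lowerE (D - s).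
    by rewrite subr_gt0.
  have {}ss' : s < s' by lra.
  (* Below [d0] the content is bounded below, and below 1 exponents can be compared. *)
  have m0 : 0 < Num.min d0 1 by rewrite lt_min d00 ltr01.
  have : (hausdorff_content s (Num.min d0 1)%R E <= 0)%E.
    by rewrite -Hs; apply: ereal_sup_ubound; exists (Num.min d0 1).
  rewrite leNgt => /negP; apply; apply: (@lt_le_trans _ _ c%:E) => //.
  apply: le_trans (le_hausdorff_content_exp _ s0 (ltW ss') _); last first.
    by rewrite ge_min lexx orbT.
  apply: le_trans cE _; apply: le_hausdorff_content_delta.
  by rewrite ge_min lexx.
apply/lee_addgt0Pr => e e0.
apply: ge_ereal_inf; exists (D + e)%:E => //; exists (D + e) => //.
split; first by lra.
apply/eqP; rewrite eq_le; apply/andP; split; last first.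
  apply: le_ereal_sup_tmp; exists (hausdorff_content (D + e) 1 E).
    by exists 1 => /=.
  exact: hausdorff_content_ge0.
apply: ge_ereal_sup => _ [d1 /= d10 <-].
have [|C [d0 [C0 d00 hC]]] := upperE (D + e / 2); first by lra.
apply/lee_addgt0Pr => t t0; rewrite add0e.
have e20 : 0 < e / 2 by lra.
have : \forall x \near (0 : R)^'+, `|0 - x `^ (e / 2)| <= t / C.
  by apply: (cvgr_dist_le _ _ (powR_cvg0 e20)); rewrite divr_gt0.
move=> H.
have : \forall x \near (0 : R)^'+,
    [/\ 0 < x, x < d0, x < d1 & `|0 - x `^ (e / 2)| <= t / C].
  near=> x; split.
  - by near: x; exact: nbhs_right_gt.
  - by near: x; exact: nbhs_right_lt.
  - by near: x; exact: nbhs_right_lt.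
  - by near: x.
move=> /filter_ex[x [x0 xd0 xd1]].
rewrite sub0r normrN ger0_norm ?powR_ge0 // => xt.
have [|n cov nC] := hC x; first by rewrite x0.
apply: (@le_trans _ _ (hausdorff_content (D + e) x E)).
  exact: le_hausdorff_content_delta (ltW xd1).
apply: le_trans (hausdorff_content_covers _ (ltW x0) cov) _; first by lra.
rewrite lee_fin; apply: (@le_trans _ _ (C * x `^ (- (D + e / 2)) * x `^ (D + e))).
  by rewrite ler_wpM2r ?powR_ge0.
rewrite -mulrA -powRD; last by apply/implyP => _; rewrite gt_eqF.
rewrite (_ : - _ + _ = e / 2); last by lra.
by rewrite mulrC -ler_pdivlMr.
Unshelve. all: by end_near.
Qed.

(** The count lies between c x^-s and C x^-(D+e/2); logarithms are taken and divided by -ln x. *)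
Lemma box_dim_of_bounds (R : realType) (E : set (R * R)) (D : R) :
  (forall e : R, 0 < e ->
    exists s : R, [/\ D - e < s, 0 < s & content_lower_bound E s]) ->
  (forall s : R, D < s -> count_upper_bound E s) ->
  box_dim_eq E D.
Proof.
move=> lowerE upperE.
apply/cvgrPdist_le => e e0.
have [|s [Ds s0 [c [d0 [c0 d00 cE]]]]] := lowerE (e / 2); first by lra.
have [|C [d1 [C0 d10 hC]]] := upperE (D + e / 2); first by lra.
have lnN := (cvgrNyPlt _).1 (@lnNy R).
near=> x.
have x0 : 0 < x by near: x; exact: nbhs_right_gt.
have xd0 : x < d0 by near: x; exact: nbhs_right_lt.
have xd1 : x < d1 by near: x; exact: nbhs_right_lt.
have x1 : ln x < 0 by near: x; exact: lnN.
(* For such x the constants [c] and [C] shift the quotient by at most [e / 2] in the harmful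
   direction. *)
have xc : ln x < (ln c) * (2 / e) by near: x; exact: lnN.
have xC : ln x < - (ln C) * (2 / e) by near: x; exact: lnN.
have [|n cov nC] := hC x; first by rewrite x0.
have lb m : covers_by E x m -> c * x `^ (- s) <= m%:R.
  by apply: content_pos_covers cE _; rewrite // x0 ltW.
have h1 : c * x `^ (- s) <= box_count E x.
  apply: lb_le_inf; first by exists n%:R; exists n.
  by move=> _ [m /= /lb hm <-].
have h2 : box_count E x <= C * x `^ (- (D + e / 2)).
  apply: le_trans nC; apply: ge_inf; last by exists n.
  by exists (c * x `^ (- s)) => _ [m /= /lb hm <-].
have p1 : 0 < c * x `^ (- s) by rewrite mulr_gt0 ?powR_gt0.
have p2 : 0 < box_count E x by exact: lt_le_trans h1.
have l1 : ln c - s * ln x <= ln (box_count E x).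
  have := h1; rewrite -ler_ln ?posrE // lnM ?posrE ?powR_gt0 // ln_powR; lra.
have l2 : ln (box_count E x) <= ln C - (D + e / 2) * ln x.
  have := h2; rewrite -ler_ln ?posrE ?mulr_gt0 ?powR_gt0 //.
  rewrite lnM ?posrE ?powR_gt0 // ln_powR; lra.
have nx : 0 < - ln x by lra.
move: xc xC; rewrite !mulrA !ltr_pdivlMr // => xc xC.
rewrite ler_distl; apply/andP; split.
- rewrite lerBlDr ler_pdivrMr //; nra.
- rewrite -lerBlDr ler_pdivlMr //; nra.
Unshelve. all: by end_near.
Qed.

(** * Hoelder graphs and periodic functions *)

(** Over a column of width of order delta the graph has height O(delta^h), so O(delta^(h-1)) squares
    cover it; there are O(1/delta) columns. *)
Lemma holder_graph_count (R : realType) (f : R -> R) (T h H s : R) :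
  0 < T -> 0 < h <= 1 -> 0 <= H -> 2 - h <= s ->
  (forall x y, 0 <= x <= T -> 0 <= y <= T ->
    `|f x - f y| <= H * `|x - y| `^ h) ->
  count_upper_bound (graph_on f 0 T) s.
Proof.
move=> T0 /andP[h0 h1] H0 hs fH.
exists ((2 * T + 1) * (4 * H + 1)), 1; split => // [|delta /andP[d0 d1]].
  by rewrite mulr_gt0 // ltr_wpDl // mulr_ge0 // ltW.
(* A square of side [delta / 2] has diameter at most [delta]. *)
pose e := delta / 2; have e0 : 0 < e by rewrite divr_gt0.
pose W := H * e `^ h; have W0 : 0 <= W by rewrite mulr_ge0 ?powR_ge0.
pose N1 := (Num.truncn (T / e)).+1; pose N2 := (Num.truncn (2 * W / e)).+1.
pose q k : R := k%:R * e.
exists (N1 * N2)%N.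
  (* The index [i] encodes the column [i %/ N2] and the row [i %% N2]; [W] bounds the distance of
     [f] from its value at the left end of a column. *)
  exists (fun i => [set p | q (i %/ N2)%N <= p.1 <= q (i %/ N2)%N + e /\
     f (q (i %/ N2)%N) - W + q (i %% N2)%N <= p.2 <=
     f (q (i %/ N2)%N) - W + q (i %% N2)%N + e]); split; last first.
    move=> i _ [x y] [x' y'] /= [/andP[? ?] /andP[? ?]] [/andP[? ?] /andP[? ?]].
    rewrite /dist2 /= -(ger0_norm (ltW d0)) -sqrtr_sqr ler_wsqrtr //.
    have -> : delta = 2 * e by rewrite /e; lra.
    have ? : `|x - x'| <= e by rewrite ler_norml; apply/andP; split; lra.
    have ? : `|y - y'| <= e by rewrite ler_norml; apply/andP; split; lra.
    have : `|x - x'| ^+ 2 <= e ^+ 2 by rewrite lerXn2r ?nnegrE // ltW.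
    have : `|y - y'| ^+ 2 <= e ^+ 2 by rewrite lerXn2r ?nnegrE // ltW.
    rewrite !real_normK ?num_real // => ? ?.
    by have := sqr_ge0 e; lra.
  move=> [x y]; rewrite /graph_on /= => -[/andP[x0 xT] ->{y}].
  have xe0 : 0 <= x / e by rewrite divr_ge0 // ltW.
  have /andP[k1 k2] := truncn_itv xe0.
  set k := Num.truncn (x / e) in k1 k2.
  have qk1 : q k <= x by rewrite /q -ler_pdivlMr.
  have qk2 : x < q k + e.
    by move: k2; rewrite ltr_pdivrMr // -natr1 mulrDl mul1r.
  have qk0 : 0 <= q k by rewrite mulr_ge0 // ltW.
  have fW : `|f x - f (q k)| <= W.
    apply: le_trans (fH _ _ _ _) _; rewrite ?x0 ?qk0 ?(le_trans qk1) //.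
    rewrite ler_wpM2l // ge0_ler_powR ?nnegrE ?(ltW h0) ?(ltW e0) //.
    by rewrite ler_norml; apply/andP; split; lra.
  have z0 : 0 <= (f x - f (q k) + W) / e.
    rewrite divr_ge0 // ?(ltW e0) //; by move: fW; rewrite ler_norml => /andP[*]; lra.
  have /andP[l1 l2] := truncn_itv z0.
  set l := Num.truncn _ in l1 l2.
  have lN : (l < N2)%N.
    rewrite ltnS; apply: le_truncn; rewrite ler_pM2r ?invr_gt0 //.
    by move: fW; rewrite ler_norml => /andP[*]; lra.
  have kN : (k < N1)%N.
    by rewrite ltnS; apply: le_truncn; rewrite ler_pM2r ?invr_gt0.
  exists (k * N2 + l)%N => /=.
    apply: (@leq_trans (k * N2 + N2)); first by rewrite ltn_add2l.
    by rewrite addnC -mulSn leq_mul2r kN orbT.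
  rewrite divnMDl // divn_small // addn0 modnMDl modn_small //.
  rewrite ler_pdivlMr // in l1; rewrite ltr_pdivrMr // in l2.
  rewrite -natr1 mulrDl mul1r in l2.
  rewrite -/(q l) in l1 l2; rewrite qk1 /= (ltW qk2); split=> //.
  by apply/andP; split; lra.
have n1 : N1%:R <= (2 * T + 1) / delta.
  have /andP[+ _] := truncn_itv (divr_ge0 (ltW T0) (ltW e0)).
  rewrite /N1 -natr1.
  rewrite -(lerD2r 1) => /le_trans; apply.
  rewrite (_ : T / e = 2 * T / delta); last by rewrite /e; field; rewrite gt_eqF.
  rewrite [leRHS]mulrDl mul1r lerD2l.
  by rewrite invf_ge1 // ltW.
(* This absorbs the extra square that comes from rounding the number of rows up. *)
have dh : 1 <= delta `^ (h - 1).
  rewrite -[leLHS](powRr0 delta); apply: ger_powR; rewrite ?d0 ?(ltW d1) //; lra.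
have n2 : N2%:R <= (4 * H + 1) * delta `^ (h - 1).
  have /andP[+ _] := truncn_itv (divr_ge0 (mulr_ge0 (ler0n R 2) W0) (ltW e0)).
  rewrite /N2 -[X in X <= _ -> _]addr0 -[X in _ -> X <= _]natr1 addr0.
  rewrite -(lerD2r 1) => /le_trans; apply.
  rewrite [leRHS]mulrDl mul1r lerD //.
  rewrite powRB; last by apply/implyP => _; rewrite gt_eqF.
  rewrite powRr1 ?(ltW d0) // (_ : 2 * W / e = 4 * W / delta); last first.
    by rewrite /e; field; rewrite gt_eqF.
  rewrite /W.
  have : e `^ h <= delta `^ h.
    by rewrite ge0_ler_powR ?nnegrE ?(ltW h0) ?(ltW e0) ?(ltW d0) // /e; lra.
  move=> /(ler_wpM2l H0) eh.
  rewrite mulrA [leRHS]mulrA ler_pM2r ?invr_gt0 //; nra.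
rewrite natrM; apply: le_trans (ler_pM (ler0n _ _) (ler0n _ _) n1 n2) _.
rewrite mulrACA ler_wpM2l //.
  by rewrite mulr_ge0 // addr_ge0 // mulr_ge0 // ltW.
rewrite -(powR_inv1 (ltW d0)) -powRD; last by apply/implyP => _; rewrite gt_eqF.
by apply: ger_powR; rewrite ?d0 ?(ltW d1) //; lra.
Qed.

(** The sum of the ratios up to [m0] takes care of the initial terms, where the recursion is not
    assumed; the added 1 makes the constant positive. *)
Lemma geometric_growth_bound (R : realType) (u : nat -> R) (beta : R) (m0 : nat) :
  0 < beta -> (forall n, 0 <= u n) ->
  (forall n, (m0 <= n)%N -> u n.+1 <= beta * u n) ->
  exists2 C, 0 < C & forall n, u n <= C * beta ^+ n.
Proof.
move=> b0 u0 ub.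
pose C := \sum_(k < m0.+1) u k / beta ^+ k + 1.
have t0 k : 0 <= u k / beta ^+ k by rewrite divr_ge0 ?exprn_ge0 // ltW.
exists C; first by rewrite ltr_wpDl // sumr_ge0.
have small n : (n <= m0)%N -> u n <= C * beta ^+ n.
  rewrite -ltnS => nm; rewrite -ler_pdivrMr ?exprn_gt0 //.
  rewrite /C (bigD1 (Ordinal nm)) //= -addrA lerDl addr_ge0 // sumr_ge0 // => *.
elim=> [|n IH]; first exact: small.
have [nm|mn] := leqP n.+1 m0; first exact: small.
apply: le_trans (ub _ _) _; first by rewrite -ltnS.
by rewrite exprS mulrCA ler_pM2l.
Qed.

Section PeriodicFunctions.
Context (R : realType).

Lemma periodic_int (phi : R -> R) (T : R) (n : int) : 
  (forall x, phi (x + T) = phi x) -> forall x, phi (x + n%:~R * T) = phi x.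
Proof.
move=> phiT; have nat_case k x : phi (x + k%:R * T) = phi x.
  elim: k x => [|k IH] x; first by rewrite mul0r addr0.
  by rewrite -natr1 mulrDl mul1r addrA phiT.
case: n => n x; first exact: nat_case.
rewrite NegzE mulrNz mulNr -[in RHS](subrK (n.+1%:R * T) x).
by rewrite nat_case.
Qed.

Lemma periodic_bounded (phi : R -> R) (T : R) : 0 < T ->
  (forall x, phi (x + T) = phi x) -> continuous phi ->
  exists2 M, 0 < M & forall x, `|phi x| <= M.
Proof.
move=> T0 phiT phic.
have phic' : {within `[0, T], continuous (fun x => `|phi x|)}.
  apply: continuous_subspaceT => x; apply: continuous_comp; first exact: phic.
  exact: norm_continuous.
have [c _ cM] := EVT_max (ltW T0) phic'.
exists (`|phi c| + 1); first by rewrite ltr_wpDl.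
move=> x; rewrite -(periodic_int (- Num.floor (x / T)) phiT x).
apply: le_trans (cM _ _) _; last by rewrite lerDl.
have /andP[l1 l2] := floor_itv (x / T).
rewrite in_itv /= mulrNz mulNr subr_ge0 -ler_pdivlMr // l1 /=.
rewrite lerBlDr addrC -[X in _ + X]mul1r -mulrDl -ler_pdivrMr //.
by move: l2; rewrite intrD => /ltW.
Qed.

Lemma periodic_derive1 (g : R -> R) (T : R) :
  (forall x, g (x + T) = g x) -> forall x, derive1 g (x + T) = derive1 g x.
Proof.
move=> gT x; rewrite /derive1.
rewrite (_ : (fun h : R => h^-1 *: (g (h + (x + T)) - g (x + T))) =
             (fun h => h^-1 *: (g (h + x) - g x))) //.
by apply/funext => t /=; rewrite addrA !gT.
Qed.

Lemma lipschitz_of_derive1 (g : R -> R) (L : R) :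
  (forall x, derivable g x 1) -> (forall x, `|derive1 g x| <= L) ->
  forall x y, `|g x - g y| <= L * `|x - y|.
Proof.
move=> dg gL.
have gc : continuous g by move=> x; apply: differentiable_continuous; apply/derivable1_diffP.
have main x y : x < y -> `|g x - g y| <= L * `|x - y|.
  move=> xy; have [c _] : exists2 c, c \in `]x, y[ &
      g y - g x = derive1 g c * (y - x).
    apply: MVT => // [z _|]; last exact: continuous_subspaceT.
    by apply: DeriveDef; [exact: dg|rewrite derive1E].
  by rewrite -normrN opprB => ->; rewrite normrM distrC ler_wpM2r.
move=> x y; have [xy|xy|->] := ltgtP x y; first exact: main.
  by rewrite distrC [in leRHS]distrC main.
by rewrite !subrr normr0 mulr0.
Qed.

(** The Lipschitz bound is the stronger one when the points are at distance at most 1; farther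
    apart, twice the supremum is enough. *)
Lemma holder_of_lipschitz (g : R -> R) (L M h : R) : 0 <= L -> 0 <= M ->
  0 < h <= 1 ->
  (forall x y, `|g x - g y| <= L * `|x - y|) -> (forall x, `|g x| <= M) ->
  forall x y, `|g x - g y| <= (L + 2 * M) * `|x - y| `^ h.
Proof.
move=> L0 M0 /andP[h0 h1] gL gM x y.
have [xy|xy] := leP `|x - y| 1.
  apply: le_trans (gL x y) _.
  apply: ler_pM => //; first by rewrite lerDl mulr_ge0.
  have [->|xy0] := eqVneq `|x - y| 0; first by rewrite powR_ge0.
  by apply: ger1_powR => //; rewrite xy lt_def xy0 normr_ge0.
apply: (@le_trans _ _ (2 * M)).
  apply: le_trans (ler_normB _ _) _; rewrite mulr_natl mulr2n; exact: lerD.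
rewrite -[leLHS]mulr1; apply: ler_pM => //; rewrite ?mulr_ge0 ?lerDr //.
rewrite -(powRr0 `|x - y|); apply: ler_powR; exact: ltW.
Qed.

End PeriodicFunctions.

(** * Series with geometrically decreasing terms *)

(** With [N = 0] this bounds the whole sum, which gives the Hoelder constant; with large [N] it
    controls the error of truncating the random series. *)
Lemma geometric_series_tail (R : realType) (c : nat -> R) (K q : R) :
  0 <= K -> 0 < q < 1 -> (forall n, `|c n| <= K * q ^+ n) ->
  cvgn (series c) /\
  forall N, `|limn (series c) - series c N| <= K * q ^+ N / (1 - q).
Proof.
move=> K0 /andP[q0 q1] cK.
have q1' : 0 < 1 - q by rewrite subr_gt0.
have cv : cvgn (series c).
  apply: normed_cvg; apply: (@series_le_cvg _ _ (geometric K q)) => //.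
  - by move=> n /=.
  - by move=> n; rewrite geometric_ge0 // ltW.
  - by apply: is_cvg_geometric_series; rewrite ger0_norm // ltW.
split => // N.
have part n : (N <= n)%N ->
    `|series c n - series c N| <= K * q ^+ N / (1 - q).
  move=> Nn; rewrite sub_series_geq //.
  apply: le_trans (ler_norm_sum _ _ _) _.
  apply: (@le_trans _ _ (\sum_(N <= k < n) K * q ^+ k)).
    by apply: ler_sum => i _.
  suff -> : \sum_(N <= k < n) K * q ^+ k = K * (q ^+ N - q ^+ n) / (1 - q).
    rewrite ler_pM2r ?invr_gt0 // ler_wpM2l // gerBl exprn_ge0 //; exact: ltW.
  rewrite -(subnKC Nn); elim: (n - N)%N => [|m IH].
    by rewrite addn0 big_geq // subrr mulr0 mul0r.
  rewrite addnS big_nat_recr ?leq_addr //= IH exprS.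
  by field; rewrite gt_eqF.
rewrite ler_distl; apply/andP; split.
- apply: limr_ge => //; near=> n.
  have := part n; rewrite ler_distl => /(_ _)/andP[] //.
  by near: n; exact: nbhs_infty_ge.
- apply: limr_le => //; near=> n.
  have := part n; rewrite ler_distl => /(_ _)/andP[] //.
  by near: n; exact: nbhs_infty_ge.
Unshelve. all: by end_near.
Qed.

(** The n-th term is Hoelder with constant of order (a beta^h)^n, and these constants are summable.
    The coefficients are deterministic here: the lemma is applied for each outcome separately. *)
Lemma series_holder (R : realType) (A b_ theta : nat -> R) (g : R -> R)
    (a beta h C K M : R) :
  0 < a < 1 -> 0 < beta -> 0 <= h -> a * beta `^ h < 1 ->
  0 <= C -> (forall n, `|b_ n| <= C * beta ^+ n) ->
  (forall n, `|A n| <= a ^+ n) ->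
  0 <= K -> 0 <= M -> (forall x y, `|g x - g y| <= K * `|x - y| `^ h) ->
  (forall x, `|g x| <= M) ->
  let F x := limn (series (fun n => A n * g (b_ n * x + theta n))) in
  forall x y,
    `|F x - F y| <= K * C `^ h / (1 - a * beta `^ h) * `|x - y| `^ h.
Proof.
move=> /andP[a0 a1] beta0 h0 abh C0 bC Aa K0 M0 gK gM F x y.
have cvx z : cvgn (series (fun n => A n * g (b_ n * z + theta n))).
  apply: (geometric_series_tail (K := M) (q := a) _ _ _).1 => //; first by rewrite a0.
  by move=> n; rewrite normrM mulrC ler_pM.
pose c n := A n * g (b_ n * x + theta n) - A n * g (b_ n * y + theta n).
have FE : F x - F y = limn (series c).
  rewrite /F -limB //; congr (limn _); apply/funext => n /=.
  by rewrite /series /= sumrB.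
rewrite [leRHS]mulrAC.
have := (@geometric_series_tail _ c (K * C `^ h * `|x - y| `^ h)
  (a * beta `^ h) _ _ _).2 0%N.
rewrite FE /series /= big_geq // subr0 expr0 mulr1.
apply.
- by rewrite !mulr_ge0 ?powR_ge0.
- by rewrite abh mulr_gt0 ?powR_gt0.
move=> n; rewrite /c -mulrBr normrM exprMn.
rewrite [leRHS](_ : _ = a ^+ n * (K * (C * beta ^+ n * `|x - y|) `^ h)); last first.
  have b0 : 0 <= beta ^+ n by rewrite exprn_ge0 // ltW.
  rewrite !powRM ?mulr_ge0 //.
  have -> : (beta ^+ n) `^ h = (beta `^ h) ^+ n.
    rewrite -!powR_mulrn ?powR_ge0 ?(ltW beta0) //.
    by rewrite -!powRrM mulrC.
  by ring.
apply: ler_pM => //; apply: le_trans (gK _ _) _; rewrite ler_wpM2l //.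
rewrite ge0_ler_powR ?nnegrE ?mulr_ge0 ?exprn_ge0 ?(ltW beta0) //.
rewrite (_ : _ - _ = b_ n * (x - y)); last by ring.
by rewrite normrM ler_wpM2r.
Qed.

(** * Covers of sets of reals by intervals of equal length *)

(** The points of [s] are left endpoints. Only the number of intervals and their common length are
    recorded, which is what bounds the measure and what composes under refinement. *)
Definition covered (R : realType) (E : set R) (K : nat) (tau : R) : Prop :=
  exists s : seq R, (size s <= K)%N /\
    forall x, E x -> exists2 c, c \in s & c <= x <= c + tau.

Lemma covered_sub (R : realType) (E E' : set R) (K K' : nat) (tau tau' : R) :
  E `<=` E' -> (K' <= K)%N -> tau' <= tau -> covered E' K' tau' -> covered E K tau.
Proof.
move=> EE KK tt [s [sK sE]]; exists s; split; first exact: leq_trans KK.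
move=> x /EE /sE [c cs /andP[c1 c2]]; exists c => //.
by rewrite c1 (le_trans c2) // lerD2l.
Qed.

Lemma coveredU (R : realType) (E1 E2 : set R) (K1 K2 : nat) (tau : R) :
  covered E1 K1 tau -> covered E2 K2 tau -> covered (E1 `|` E2) (K1 + K2) tau.
Proof.
move=> [s [sK sE]] [t [tK tE]]; exists (s ++ t); split.
  by rewrite size_cat leq_add.
by move=> x [/sE|/tE] [c cs cx]; exists c => //; rewrite mem_cat cs ?orbT.
Qed.

Lemma covered_measure (R : realType) (E : set R) (K : nat) (tau : R) :
  0 <= tau -> measurable E -> covered E K tau ->
  (lebesgue_measure E <= (K%:R * tau)%:E)%E.
Proof.
move=> tau0 mE [s [sK sE]].
apply: (@le_trans _ _ ((size s)%:R * tau)%:E); last first.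
  by rewrite lee_fin ler_wpM2r // ler_nat.
elim: s {K sK} E mE sE => [|c s IH] E mE sE.
  rewrite (_ : E = set0) ?measure0 ?mul0r //.
  by apply/seteqP; split => // x /sE[].
have mI : measurable `[c, c + tau]%classic by exact: measurable_itv.
have -> : E = (E `&` `[c, c + tau]%classic) `|` (E `\` `[c, c + tau]%classic).
  by rewrite setUIDK.
apply: le_trans (measureU2 _ _ _) _; [exact: measurableI|exact: measurableD|].
rewrite /= -add1n natrD mulrDl mul1r EFinD; apply: leeD.
  apply: (@le_trans _ _ (lebesgue_measure `[c, c + tau]%classic)).
    apply: le_measure; [| |by move=> x []]; rewrite inE //.
    exact: measurableI.
  rewrite lebesgue_measure_itv /= lte_fin; case: ifP => _; last by rewrite lee_fin.
  by rewrite -EFinD lee_fin addrAC subrr add0r.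
apply: IH; first exact: measurableD.
move=> x [Ex xc]; have [c' + cx] := sE _ Ex.
rewrite inE => /orP[/eqP cc|c's]; last by exists c'.
by exfalso; apply: xc; rewrite /= in_itv /= -cc.
Qed.

(** * Level sets of periodic functions *)

(** A continuous injective [g] is strictly monotone, so two points more than [tau] apart have values
    differing by more than the least increment over a step [tau]. A thin enough level set thus has
    diameter at most [tau]. *)
Lemma level_cover_injective (R : realType) (g : R -> R) (u v : R) :
  continuous g -> u <= v -> {in `[u, v] &, injective g} ->
  forall tau, 0 < tau -> exists2 delta, 0 < delta &
    forall w, covered [set x | u <= x <= v /\ `|g x - w| <= delta] 1 tau.
Proof.
move=> gc uv gI tau tau0.
have [vut|vut] := leP (v - u) tau.
  exists 1 => // w; exists [:: u]; split => // x [/andP[ux xv] _].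
  by exists u; rewrite ?inE // ux /=; lra.
have gmono : {in `[u, v] &, {homo g : x y / x < y}} \/
             {in `[u, v] &, {homo g : x y /~ x < y}}.
  by apply: itv_continuous_inj_mono => //; exact: continuous_subspaceT.
pose phi x := `|g (x + tau) - g x|.
have phic : continuous phi.
  move=> x; apply: cvg_norm; apply: cvgB; last exact: gc.
  apply: (@continuous_comp _ _ _ (fun y => y + tau) g); last exact: gc.
  by apply: cvgD; [exact: cvg_id|exact: cvg_cst].
have uvt : u <= v - tau by lra.
have [c + cmin] := EVT_min uvt (continuous_subspaceT phic).
rewrite in_itv /= => /andP[c1 c2].
have phic0 : 0 < phi c.
  rewrite normr_gt0 subr_eq0; apply/eqP => /gI.
  rewrite !in_itv /= => /(_ _ _)/eqP; rewrite -subr_eq0 addrAC subrr add0r.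
  rewrite (gt_eqF tau0) => H; have : false; last by [].
  by apply: H; apply/andP; split; lra.
(* Two values within a third of [phi c] of the same [w] differ by less than [phi c]. *)
exists (phi c / 3); first by rewrite divr_gt0.
have key x y w : u <= x -> y <= v -> x + tau < y ->
    `|g x - w| <= phi c / 3 -> `|g y - w| <= phi c / 3 -> False.
  move=> ux yv xy gx gy.
  have xI : x \in `[u, v - tau] by rewrite in_itv /= ux /=; lra.
  have := cmin x xI; rewrite {2}/phi => h.
  have i1 : x \in `[u, v] by rewrite in_itv /= ux /=; lra.
  have i2 : x + tau \in `[u, v] by rewrite in_itv /=; apply/andP; split; lra.
  have i3 : y \in `[u, v] by rewrite in_itv /=; apply/andP; split; lra.
  have x1 : x < x + tau by lra.
  move: gx gy; rewrite !ler_norml => /andP[? ?] /andP[? ?].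
  case: gmono => gm.
    have g1 := gm _ _ i1 i2 x1; have g2 := gm _ _ i2 i3 xy.
    by move: h; rewrite ger0_norm; lra.
  have g1 := gm _ _ i2 i1 x1; have g2 := gm _ _ i3 i2 xy.
  by move: h; rewrite ler0_norm; lra.
move=> w; set E := [set _ | _].
have [E0|/set0P/negP] := pselect (E !=set0); last first.
  by rewrite negbK => /eqP ->; exists [::]; split.
exists [:: inf E]; split => // x [/andP[ux xv] gx].
exists (inf E); rewrite ?inE //; apply/andP; split.
  by apply: ge_inf; [exists u => y [/andP[]]|split => //; apply/andP].
rewrite -lerBlDr; apply: lb_le_inf => // y [/andP[uy yv] gy].
rewrite lerBlDr leNgt; apply/negP => yx.
exact: (key y x w).
Qed.

Lemma injective_of_no_critical (R : realType) (g : R -> R) (u v : R) :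
  (forall x, derivable g x 1) -> 
  (forall x, u < x < v -> derive1 g x != 0) -> {in `[u, v] &, injective g}.
Proof.
move=> dg g0; have gc : continuous g.
  by move=> x; apply: differentiable_continuous; apply/derivable1_diffP.
have main x y : u <= x -> y <= v -> x < y -> g x <> g y.
  move=> ux yv xy gxy.
  have [c] := Rolle xy (fun z _ => dg z) (continuous_subspaceT gc) gxy.
  rewrite in_itv /= => /andP[xc cy] Hc.
  have := g0 c; rewrite derive1E derive_val eqxx => H.
  have : false; last by [].
  by apply: H; apply/andP; split; [exact: le_lt_trans xc|exact: lt_le_trans yv].
move=> x y; rewrite !in_itv /= => /andP[ux xv] /andP[uy yv] gxy.
have [xy|xy|//] := ltgtP x y; first by case: (main x y).
by case: (main y x).
Qed.

(* The number K of intervals does not depend on their length tau; this is what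
   makes the iteration over scales in [bad_set_covered] lose only K^(1/q) per scale. *)
Lemma level_cover (R : realType) (g : R -> R) (s : seq R) (u v : R) :
  (forall x, derivable g x 1) -> u <= v ->
  (forall x, u < x < v -> derive1 g x = 0 -> x \in s) ->
  exists K, forall tau, 0 < tau -> exists2 delta, 0 < delta &
    forall w, covered [set x | u <= x <= v /\ `|g x - w| <= delta] K tau.
Proof.
move=> dg; have gc : continuous g.
  by move=> x; apply: differentiable_continuous; apply/derivable1_diffP.
elim: s u v => [|c s IH] u v uv crit.
  exists 1; apply: level_cover_injective => //.
  apply: injective_of_no_critical => // x ux; apply/eqP => /(crit _ ux).
  by rewrite in_nil.
have [/andP[uc cv]|cuv] := boolP (u < c < v); last first.
  apply: IH => // x ux gx; have := crit x ux gx; rewrite inE => /orP[/eqP xc|//].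
  by rewrite -xc ux in cuv.
(* The critical point [c] cuts the interval in two. It is interior to neither half, so the remaining
   list [s] serves both; the counts add up and the smaller delta is kept. *)
have [K1 H1] : exists K, forall tau, 0 < tau -> exists2 delta, 0 < delta &
    forall w, covered [set x | u <= x <= c /\ `|g x - w| <= delta] K tau.
  apply: IH; first exact: ltW.
  move=> x /andP[ux xc] gx; have := crit x _ gx; rewrite ux (lt_trans xc cv).
  by move=> /(_ isT); rewrite inE => /orP[/eqP xc'|//]; rewrite xc' ltxx in xc.
have [K2 H2] : exists K, forall tau, 0 < tau -> exists2 delta, 0 < delta &
    forall w, covered [set x | c <= x <= v /\ `|g x - w| <= delta] K tau.
  apply: IH; first exact: ltW.
  move=> x /andP[ux xc] gx; have := crit x _ gx; rewrite xc (lt_trans uc ux).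
  by move=> /(_ isT); rewrite inE => /orP[/eqP xc'|//]; rewrite xc' ltxx in ux.
exists (K1 + K2)%N => tau tau0.
have [d1 d10 {}H1] := H1 _ tau0; have [d2 d20 {}H2] := H2 _ tau0.
exists (Num.min d1 d2); first by rewrite lt_min d10.
move=> w; apply: covered_sub (leqnn _) (lexx _) (coveredU (H1 w) (H2 w)).
move=> x [/andP[ux xv]]; rewrite le_min => /andP[x1 x2].
by have [xc|/ltW xc] := leP x c; [left|right]; split => //; apply/andP.
Qed.

(** A window of length [T] is moved by a multiple of the period into [[0, 2 * T]], which makes delta
    uniform in the window. *)
Lemma periodic_level_cover (R : realType) (g : R -> R) (T : R) :
  0 < T -> (forall x, derivable g x 1) -> (forall x, g (x + T) = g x) ->
  (forall u v, finite_set [set x | u <= x <= v /\ derive1 g x = 0]) ->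
  exists K, forall tau, 0 < tau -> exists2 delta, 0 < delta &
    forall w z, covered [set x | z <= x <= z + T /\ `|g x - w| <= delta] K tau.
Proof.
move=> T0 dg gT fin.
have [s sE] := (finite_seqP _).1 (fin 0 (2 * T)).
have T20 : 0 <= 2 * T by rewrite mulr_ge0 // ltW.
have [x /andP[x0 xT] gx|K HK] := @level_cover _ g s 0 (2 * T) dg T20.
  by have : [set` s] x by rewrite -sE /= (ltW x0) (ltW xT).
exists K => tau /HK [delta delta0 {}HK]; exists delta => // w z.
have [t [tK tE]] := HK w.
have /andP[n1 n2] := floor_itv (z / T).
set n := Num.floor (z / T) in n1 n2.
exists (map (fun c => c + n%:~R * T) t); split; first by rewrite size_map.
move=> x [/andP[zx xz] gx].
have [|c ct cx] := tE (x - n%:~R * T).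
  rewrite ler_pdivlMr // in n1.
  rewrite ltr_pdivrMr // intrD mulrDl mul1r in n2.
  split; first by apply/andP; split; lra.
  by have := periodic_int (- n) gT x; rewrite mulrNz mulNr => ->.
exists (c + n%:~R * T); first by apply/mapP; exists c.
by move: cx => /andP[? ?]; apply/andP; split; lra.
Qed.

(** A change of variables in which [delta] and [K] do not depend on the frequency [B]: one choice
    works at all scales. *)
Lemma affine_level_cover (R : realType) (g : R -> R) (T : R) :
  0 < T -> (forall x, derivable g x 1) -> (forall x, g (x + T) = g x) ->
  (forall u v, finite_set [set x | u <= x <= v /\ derive1 g x = 0]) ->
  exists K, forall tau, 0 < tau -> exists2 delta, 0 < delta &
    forall B th w c, B != 0 -> covered
      [set x | c <= x <= c + T / `|B| /\ `|g (B * x + th) - w| <= delta]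
      K (tau / `|B|).
Proof.
move=> T0 dg gT fin.
have [K HK] := periodic_level_cover T0 dg gT fin.
exists K => tau /HK [delta delta0 {}HK]; exists delta => // B th w c.
rewrite neq_lt => /orP[B0|B0].
  rewrite ltr0_norm //.
  have [t [tK tE]] := HK w (B * c + th - T).
  (* For negative [B] the map reverses order, so the right end of an interval yields the left end of
     its preimage. *)
  exists (map (fun p => (p + tau - th) / B) t); split; first by rewrite size_map.
  move=> x [/andP[cx xc] gx].
  have [|p pt /andP[p1 p2]] := tE (B * x + th).
    split => //.
    have : (x - c) * - B <= T by rewrite -ler_pdivlMr ?oppr_gt0 //; lra.
    by move=> ?; apply/andP; split; nra.
  exists ((p + tau - th) / B); first by apply/mapP; exists p.
  rewrite invrN mulrN -mulNr -mulrDl ler_ndivrMr // ler_ndivlMr //.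
  by apply/andP; split; lra.
rewrite gtr0_norm //.
have [t [tK tE]] := HK w (B * c + th).
exists (map (fun p => (p - th) / B) t); split; first by rewrite size_map.
move=> x [/andP[cx xc] gx].
have [|p pt /andP[p1 p2]] := tE (B * x + th).
  split => //.
  have : (x - c) * B <= T by rewrite -ler_pdivlMr //; lra.
  by move=> ?; apply/andP; split; nra.
exists ((p - th) / B); first by apply/mapP; exists p.
rewrite -mulrDl ler_pdivrMr // ler_pdivlMr //.
by apply/andP; split; lra.
Qed.

Lemma covered_bind (R : realType) (E : set R) (K1 K2 : nat) (tau1 tau2 : R) :
  covered E K1 tau1 ->
  (forall c, covered (E `&` [set x | c <= x <= c + tau1]) K2 tau2) ->
  covered E (K1 * K2) tau2.
Proof.
move=> [s [sK sE]] /choice[t tP].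
exists (flatten (map t s)); split.
  apply: (@leq_trans (size s * K2)); last by rewrite leq_mul2r sK orbT.
  elim: s {sK sE} => [//|c s IH] /=.
  by rewrite size_cat mulSn leq_add // (tP c).1.
move=> x Ex; have [c cs cx] := sE x Ex.
have [|c' c't c'x] := (tP c).2 x; first by split.
by exists c' => //; apply/flattenP; exists (t c) => //; apply: map_f.
Qed.

Lemma covered_itv (R : realType) (T tau : R) : 0 < T -> 0 < tau ->
  exists K, covered [set x | 0 <= x <= T] K tau.
Proof.
move=> T0 tau0; exists (Num.truncn (T / tau)).+1.
exists (map (fun k => k%:R * tau) (iota 0 (Num.truncn (T / tau)).+1)).
split; first by rewrite size_map size_iota.
move=> x /andP[x0 xT].
have /andP[k1 k2] := truncn_itv (divr_ge0 x0 (ltW tau0)).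
exists ((Num.truncn (x / tau))%:R * tau).
  apply: (map_f (fun k => k%:R * tau)); rewrite mem_iota /= add0n ltnS.
  by apply: le_truncn; rewrite ler_pM2r ?invr_gt0.
rewrite ler_pdivlMr // in k1; rewrite k1 /=.
by rewrite ltr_pdivrMr // -natr1 mulrDl mul1r in k2; apply: ltW.
Qed.

Lemma lacunary_of_ratio (R : realType) (b_ : nat -> R) (b beta beta' : R) :
  0 < beta -> beta < b -> b < beta' -> (fun n => b_ n.+1 / b_ n) @ \oo --> b ->
  exists m0, forall n, (m0 <= n)%N ->
    [/\ b_ n != 0, beta * `|b_ n| <= `|b_ n.+1| & `|b_ n.+1| <= beta' * `|b_ n|].
Proof.
move=> beta0 bb bb' cvb.
have : \forall n \near \oo, beta < b_ n.+1 / b_ n < beta'.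
  near=> n; apply/andP; split; near: n.
    by apply: cvgr_gt cvb _ bb.
  by apply: cvgr_lt cvb _ bb'.
move=> [m0 _ Hm]; exists m0 => n /Hm /= /andP[h1 h2].
(* Division by 0 gives 0, so a ratio above [beta > 0] excludes [b_ n = 0]. *)
have b0 : b_ n != 0.
  by apply: contraTneq h1 => ->; rewrite invr0 mulr0 -leNgt ltW.
have E : `|b_ n.+1| = b_ n.+1 / b_ n * `|b_ n|.
  rewrite -{1}(divfK b0 (b_ n.+1)) normrM ger0_norm // ltW //.
  exact: lt_trans h1.
have n0 : 0 < `|b_ n| by rewrite normr_gt0.
by split => //; rewrite E ler_wpM2r // ltW.
Unshelve. all: by end_near.
Qed.

(** Only every [q]-th scale is used. Passing from one used scale to the next multiplies the number
    of intervals by a [K] that does not depend on [q], while [delta] may depend on it. *)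
Lemma bad_set_covered (R : realType) (g : R -> R) (T beta' : R)
    (b_ theta : nat -> R) (m0 : nat) :
  0 < T -> (forall x, derivable g x 1) -> (forall x, g (x + T) = g x) ->
  (forall u v, finite_set [set x | u <= x <= v /\ derive1 g x = 0]) ->
  0 < beta' ->
  (forall n, (m0 <= n)%N -> b_ n != 0 /\ `|b_ n.+1| <= beta' * `|b_ n|) ->
  exists K K1, forall q, exists2 delta, 0 < delta & forall w i, covered
     [set x | 0 <= x <= T /\ forall l, (l < i)%N ->
       `|g (b_ (m0 + l * q)%N * x + theta (m0 + l * q)%N) - w (m0 + l * q)%N|
         <= delta] (K1 * K ^ i) (T / `|b_ (m0 + i * q)%N|).
Proof.
move=> T0 dg gT fin b'0 bb.
have [K HK] := affine_level_cover T0 dg gT fin.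
have bn0 n : (m0 <= n)%N -> 0 < `|b_ n| by move=> /bb[? _]; rewrite normr_gt0.
have [K1 HK1] : exists K, covered [set x | 0 <= x <= T] K (T / `|b_ m0|).
  by apply: covered_itv => //; rewrite divr_gt0 // bn0.
exists K, K1 => q.
have growth n k : (m0 <= n)%N -> `|b_ (n + k)%N| <= beta' ^+ k * `|b_ n|.
  move=> mn; elim: k => [|k IH]; first by rewrite addn0 mul1r.
  rewrite addnS; apply: le_trans (bb _ _).2 _; first exact: leq_trans (leq_addr _ _).
  by rewrite exprS -mulrA ler_pM2l.
(* Divided by |b_n|, this length is at most T / |b_(n+q)|, the length of the window required at the
   next used scale. *)
have [|delta delta0 {}HK] := HK (T / beta' ^+ q).
  by rewrite divr_gt0 ?exprn_gt0.
exists delta => // w; elim=> [|i IH].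
  rewrite mul0n addn0 expn0 muln1.
  by apply: covered_sub HK1 => // x [].
rewrite expnSr mulnA; apply: covered_bind.
  apply: covered_sub (leqnn _) (lexx _) IH => x [x0 xl]; split => // l li.
  by apply: xl; exact: ltnW.
move=> c; have mi : (m0 <= m0 + i * q)%N by exact: leq_addr.
apply: covered_sub (leqnn _) _
  (HK (b_ (m0 + i * q)%N) (theta (m0 + i * q)%N) (w (m0 + i * q)%N) c _).
- by move=> x [[_ xl] cx]; split => //; exact: xl.
- rewrite -mulrA ler_pM2l // -invfM lef_pV2 ?posrE ?mulr_gt0 ?exprn_gt0 ?bn0 //.
    by rewrite mulSn addnA addnAC; exact: growth.
  exact: leq_addr.
- by have [] := bb _ mi.
Qed.

(** After i refinements the total length is O(K^i beta^(-q i)), which is O(lam^(q i)) once [q] is so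
    large that K <= (lam beta)^q. *)
Lemma bad_set_measure (R : realType) (g : R -> R) (T b lam : R)
    (b_ theta : nat -> R) :
  0 < T -> (forall x, derivable g x 1) -> (forall x, g (x + T) = g x) ->
  (forall u v, finite_set [set x | u <= x <= v /\ derive1 g x = 0]) ->
  1 < b -> (fun n => b_ n.+1 / b_ n) @ \oo --> b ->
  b^-1 < lam < 1 ->
  exists delta C, [/\ 0 < delta, 0 < C & forall w j (E : set R), measurable E ->
    E `<=` [set x | 0 <= x <= T /\ forall m, (m < j)%N ->
              `|g (b_ m * x + theta m) - w m| <= delta] ->
    (lebesgue_measure E <= (C * lam ^+ j)%:E)%E].
Proof.
move=> T0 dg gT fin b1 cvb /andP[lamb lam1].
have b0 : 0 < b by exact: lt_trans b1.
have lam0 : 0 < lam by apply: lt_trans lamb; rewrite invr_gt0.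
(* Being below [b], this is eventually a lower growth rate of [b_]; being above [lam^-1], it makes
   [lam * beta > 1]. *)
pose beta := (lam^-1 + b) / 2.
have lamb' : lam^-1 < b by rewrite -[b]invrK ltf_pV2 ?posrE ?invr_gt0.
have lamV1 : 1 < lam^-1 by rewrite invf_gt1.
have beta_b : beta < b by rewrite /beta; lra.
have lam_beta : lam^-1 < beta by rewrite /beta; lra.
have beta0 : 0 < beta by lra.
have bb1 : b < b + 1 by rewrite ltrDl.
have [m0 Hm] := lacunary_of_ratio beta0 beta_b bb1 cvb.
have [||K [K1 HK]] := @bad_set_covered R g T (b + 1) b_ theta m0 T0 dg gT fin.
- by lra.
- by move=> n /Hm[].
have lamb1 : 1 < lam * beta by rewrite -ltr_pdivrMl // mulr1.
have [q [q0 Kq]] : exists q, (0 < q)%N /\ K%:R <= (lam * beta) ^+ q.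
  have lb1 : `|(lam * beta)^-1| < 1.
    by rewrite ger0_norm ?invf_lt1 // ?invr_ge0; lra.
  have H : \forall n \near \oo,
      (0 < n)%N /\ `|0 - geometric K%:R (lam * beta)^-1 n| <= 1.
    near=> n; split; first by near: n; exact: nbhs_infty_gt.
    by near: n; apply: (cvgr_dist_le _ _ (cvg_geometric K%:R lb1)).
  have [q [q0]] := filter_ex H.
  rewrite sub0r normrN /= exprVn => /ler_normlW.
  by rewrite ler_pdivrMr ?mul1r ?exprn_gt0 //; [exists q|lra].
have [delta delta0 Hd] := HK q.
have bm0 : 0 < `|b_ m0| by rewrite normr_gt0; have [] := Hm _ (leqnn m0).
have growth k : beta ^+ k * `|b_ m0| <= `|b_ (m0 + k)%N|.
  elim: k => [|k IH]; first by rewrite addn0 mul1r.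
  rewrite addnS; have [_ h _] := Hm _ (leq_addr k m0); apply: le_trans h.
  by rewrite exprS -mulrA ler_pM2l.
have C0 : 0 <= K1%:R * (T / `|b_ m0|) / lam ^+ (m0 + q).
  by rewrite !mulr_ge0 ?invr_ge0 ?exprn_ge0 // ltW.
(* The division by lam^(m0+q) pays for rounding [j] down to m0 + q i; the added 1 keeps the constant
   positive even if [K1] is 0. *)
exists delta, (K1%:R * (T / `|b_ m0|) / lam ^+ (m0 + q) + 1); split => //.
  by rewrite ltr_wpDl.
(* For [j < m0] the subtraction gives 0, so [i = 0] and no refinement takes place. *)
move=> w j E mE EE; pose i := ((j - m0) %/ q)%N.
have Ecov : covered E (K1 * K ^ i) (T / `|b_ (m0 + i * q)%N|).
  apply: covered_sub (leqnn _) (lexx _) (Hd w i) => x /EE [x0 xm]; split => //.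
  move=> l li; apply: xm; rewrite -ltn_subRL.
  by apply: (@leq_trans (i * q)); [rewrite ltn_pmul2r|exact: leq_divM].
have tau0 : 0 <= T / `|b_ (m0 + i * q)%N| by rewrite divr_ge0 // ltW.
apply: le_trans (covered_measure tau0 mE Ecov) _; rewrite lee_fin.
apply: (@le_trans _ _ (K1%:R * (T / `|b_ m0|) * lam ^+ (q * i))).
  rewrite natrM -!mulrA ler_wpM2l // natrX.
  have bi0 : 0 < beta ^+ (q * i) by rewrite exprn_gt0.
  rewrite [leRHS](_ : _ = (lam * beta) ^+ (q * i) *
      (T / (beta ^+ (q * i) * `|b_ m0|))); last first.
    rewrite exprMn; field.
    by rewrite !gt_eqF.
  apply: ler_pM => //.
    by rewrite exprM lerXn2r ?nnegrE ?exprn_ge0 // ltW // mulr_gt0.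
  rewrite ler_pM2l // lef_pV2 ?posrE ?mulr_gt0 //.
    by rewrite mulnC; exact: growth.
  by have [? _ _] := Hm _ (leq_addr (i * q) m0); rewrite normr_gt0.
apply: (@le_trans _ _ (K1%:R * (T / `|b_ m0|) / lam ^+ (m0 + q) * lam ^+ j)).
  rewrite -[leRHS]mulrA ler_wpM2l //.
    by rewrite mulr_ge0 // divr_ge0 // ltW.
  rewrite mulrC ler_pdivlMr ?exprn_gt0 // -exprD.
  apply: ler_wiXn2l; [exact: ltW|exact: ltW|].
  rewrite addnCA -leq_subLR; apply: ltnW.
  by rewrite addnC mulnC -mulSn; exact: ltn_ceil.
by rewrite ler_wpM2r ?exprn_ge0 ?(ltW lam0) // lerDl.
Unshelve. all: by end_near.
Qed.

(** * Anticoncentration of random sums *)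

(** The cells of the grid of mesh [eta], numbered through the encoding of integers as naturals; a
    number that encodes no integer gets the empty cell. *)
Lemma small_partition (R : realType) (eta : R) : 0 < eta ->
  exists (J : nat -> set R) (z : nat -> R),
    [/\ forall n, measurable (J n), trivIset setT J, \bigcup_n J n = setT &
        forall n x, J n x -> `|x - z n| <= eta].
Proof.
move=> eta0; pose cell (x : R) : int := Num.floor (x / eta).
pose J n := [set x : R | pickle (cell x) = n].
have Jitv n x0 : J n x0 ->
    J n = `[(cell x0)%:~R * eta, (cell x0)%:~R * eta + eta[%classic.
  move=> Jx0; apply/seteqP; split => x /=; rewrite in_itv /=.
    rewrite -Jx0 => /(pcan_inj pickleK) <-.
    have /andP[h1 h2] := floor_itv (x / eta).
    rewrite -ler_pdivlMr // h1 /=.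
    by move: h2; rewrite intrD ltr_pdivrMr // mulrDl mul1r.
  move=> /andP[h1 h2]; rewrite /J /= -Jx0; congr pickle.
  apply: floor_def; rewrite ler_pdivlMr // h1 /=.
  by rewrite intrD ltr_pdivrMr // mulrDl mul1r.
have Jalt n : J n = set0 \/ exists x0, J n x0.
  by have [->|/set0P] := eqVneq (J n) set0; [left|right].
have /choice[z zP] : forall n, exists z, forall x, J n x -> `|x - z| <= eta.
  move=> n; have [->|[x0 Jx0]] := Jalt n; first by exists 0.
  exists ((cell x0)%:~R * eta) => x; rewrite (Jitv _ _ Jx0) /= in_itv /=.
  by move=> /andP[? ?]; rewrite ger0_norm; lra.
exists J, z; split => //.
- by move=> n; have [->|[x0 /Jitv ->]] := Jalt n.
- by apply/trivIsetP => i j _ _ ij; apply/seteqP; split => // x [xi xj];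
    move: ij; rewrite -(xi : pickle (cell x) = i) -(xj : pickle (cell x) = j) eqxx.
- by apply/seteqP; split => // x _; exists (pickle (cell x)).
Qed.

Section AntiConcentration.
Context (R : realType) (d : measure_display) (Omega : measurableType d)
  (P : probability Omega R).

Definition cylinder (X : nat -> Omega -> R) (F : seq nat) (A : nat -> set R) :=
  \bigcap_(i in [set i | i \in F]) (X i @^-1` A i).

Lemma measurable_preimage (X : Omega -> R) (A : set R) :
  measurable_fun setT X -> measurable A -> measurable (X @^-1` A).
Proof. by move=> mX mA; rewrite -[_ @^-1` _]setTI; exact: mX. Qed.

Lemma measurable_norm_le d' (T : measurableType d') (f : T -> R) (r : R) :
  measurable_fun setT f -> measurable [set x | `|f x| <= r].
Proof.
move=> mf; rewrite -[X in measurable X]setTI.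
have -> : [set x | `|f x| <= r] = (fun x => `|f x|) @^-1` `]-oo, r]%classic.
  by apply/seteqP; split => x /=; rewrite in_itv.
have mn : measurable_fun setT (fun x => `|f x|) by exact: measurableT_comp.
by apply: mn.
Qed.

Lemma cylinder_cons (X : nat -> Omega -> R) (F : seq nat) (A : nat -> set R)
    (j : nat) (J : set R) : j \notin F ->
  cylinder X (j :: F) (fun i => if i == j then J else A i) =
  (X j @^-1` J) `&` cylinder X F A.
Proof.
move=> jF; apply/seteqP; split => w /=.
  move=> h; split.
    by have := h j (mem_head _ _); rewrite /= eqxx.
  move=> i iF; have := h i; rewrite /= inE iF orbT => /(_ isT).
  by case: eqP => // ij; rewrite -ij iF in jF.
move=> [hj hF] i; rewrite /= inE => /orP[/eqP ->|iF]; first by rewrite eqxx.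
by case: eqP => [->//|_]; exact: hF.
Qed.

Lemma measurable_cylinder (X : nat -> Omega -> R) (F : seq nat)
    (A : nat -> set R) : (forall n, measurable_fun setT (X n)) ->
  (forall i, i \in F -> measurable (A i)) -> measurable (cylinder X F A).
Proof.
move=> mX mA; apply: fin_bigcap_measurable.
  exact: finite_seq.
by move=> i /= iF; apply: measurable_preimage => //; exact: mA.
Qed.

(** The event confines X to an interval of length 2 r / |v|, and the density of X is at most 1 / (2
    c). *)
Lemma uniform_interval (X : Omega -> R) (c r w v : R) : 0 < c -> 0 <= r ->
  v != 0 -> uniform_on_sym P X c ->
  (P (X @^-1` [set x | (`|x * v - w| <= r)%R]) <= (r / (`|v| * c))%:E)%E.
Proof.
move=> c0 r0 v0 unif.
have v0' : 0 < `|v| by rewrite normr_gt0.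
have -> : [set x | `|x * v - w| <= r] = `[w / v - r / `|v|, w / v + r / `|v|]%classic.
  apply/seteqP; split => x /=; rewrite in_itv /= -ler_distl ler_pdivlMr //;
    by rewrite -normrM mulrBl divfK.
rewrite unif; last exact: measurable_itv.
apply: (@le_trans _ _ ((2 * (r / `|v|))%:E * ((2 * c)^-1)%:E)%E); last first.
  rewrite -EFinM lee_fin le_eqVlt; apply/orP; left; apply/eqP.
  by field; rewrite !gt_eqF.
apply: lee_wpmul2r; first by rewrite lee_fin invr_ge0 mulr_ge0 // ltW.
apply: (@le_trans _ _ (lebesgue_measure `[w / v - r / `|v|, w / v + r / `|v|]%classic)).
  apply: le_measure; rewrite ?inE; [|exact: measurable_itv|by move=> x []].
  by apply: measurableI; exact: measurable_itv.
rewrite lebesgue_measure_itv /= lte_fin; case: ifP => _; last first.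
  by rewrite lee_fin mulr_ge0 // divr_ge0 // ltW.
by rewrite -EFinD lee_fin; lra.
Qed.

(* The variables other than X k are frozen on the cells of a fine partition,
   so that only independence of cylinder events is used. *)
Lemma anticoncentration_cylinder (X : nat -> Omega -> R) (a : R)
    (c : nat -> R) (k : nat) (eta : R) :
  (forall n, measurable_fun setT (X n)) -> mutually_independent P X ->
  0 < a -> uniform_on_sym P (X k) (a ^+ k) -> c k != 0 -> 0 < eta ->
  forall S F A r w, uniq (k :: S ++ F) ->
    (forall i, i \in F -> measurable (A i)) -> 0 <= r ->
  (P (cylinder X F A `&`
     [set om | (`|X k om * c k + \sum_(j <- S) X j om * c j - w| <= r)%R]) <=
   ((r + eta * \sum_(j <- S) `|c j|) / (`|c k| * a ^+ k))%:E *
     P (cylinder X F A))%E.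
Proof.
move=> mX indep a0 unif ck0 eta0.
have ak0 : 0 < a ^+ k by rewrite exprn_gt0.
(* The induction moves the variables of [S] one by one into the cylinder. When none is left, [X k]
   is independent of the cylinder and its density gives the bound. *)
elim=> [|j S IH] F A r w.
  rewrite /= => /andP[kF uF] mA r0.
  have mI : measurable [set x | `|x * c k - w| <= r].
    by apply: measurable_norm_le; apply: measurable_funB => //; exact: measurable_funM.
  have -> : cylinder X F A `&`
     [set om | `|X k om * c k + \sum_(j <- [::]) X j om * c j - w| <= r] =
     cylinder X (k :: F) (fun i => if i == k then [set x | `|x * c k - w| <= r]
       else A i).
    rewrite cylinder_cons // setIC; congr (_ `&` _).
    by apply/seteqP; split => om /=; rewrite big_nil addr0.
  rewrite /cylinder indep ?big_cons ?eqxx //=; last 2 first.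
  - by rewrite kF.
  - by move=> i; rewrite inE; case: eqP => //= _; exact: mA.
  rewrite indep // big_nil mulr0 addr0.
  rewrite [X in (_ * X <= _)%E](_ : _ = \prod_(i <- F) P (X i @^-1` A i))%E; last first.
    apply: eq_big_seq => i iF; case: eqP => // ik; by rewrite -ik iF in kF.
  apply: lee_wpmul2r; last exact: uniform_interval.
  by apply: prode_ge0.
move=> uS mA r0.
have [J [z [mJ tJ UJ zJ]]] := small_partition eta0.
move: uS; rewrite /= inE !mem_cat !negb_or.
move=> /and3P[/and3P[kj kS kF] /andP[jS jF] uSF].
have uS' : uniq (k :: S ++ j :: F).
  rewrite /= mem_cat inE !negb_or kj kS kF (uniq_catCA S [:: j] F) /=.
  by rewrite mem_cat negb_or jS jF.
set Ev := [set om | _].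
have mcyl : measurable (cylinder X F A) by exact: measurable_cylinder.
have mEv : measurable Ev.
  apply: measurable_norm_le; apply: measurable_funB => //.
  apply: measurable_funD; first exact: measurable_funM.
  by apply: measurable_sum => i; exact: measurable_funM.
pose B n i := if i == j then J n else A i.
have mB n i : i \in j :: F -> measurable (B n i).
  by rewrite inE /B; case: eqP => //= _; exact: mA.
set C := (X in (X%:E * _)%E).
have step n : (P ((cylinder X F A `&` Ev) `&` (X j @^-1` J n)) <=
    C%:E * P (X j @^-1` J n `&` cylinder X F A))%E.
  (* On the n-th cell [X j] is replaced by [z n]: the centre [w] shifts, and the radius grows by the
     freezing error eta |c_j|. *)
  have := IH (j :: F) (B n) (r + eta * `|c j|) (w - z n * c j) uS' (mB n).
  rewrite addr_ge0 ?mulr_ge0 // ?(ltW eta0) // => /(_ isT).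
  rewrite cylinder_cons // (_ : r + _ + _ = r + eta * \sum_(i <- j :: S) `|c i|); last first.
    by rewrite big_cons; ring.
  apply: le_trans; apply: le_measure; rewrite ?inE.
  - by apply: measurableI; [exact: measurableI|exact: measurable_preimage].
  - apply: measurableI; first by apply: measurableI => //; exact: measurable_preimage.
    apply: measurable_norm_le; apply: measurable_funB => //.
    apply: measurable_funD; first exact: measurable_funM.
    by apply: measurable_sum => i; exact: measurable_funM.
  - move=> om [[cylom]]; rewrite /Ev /= big_cons => h1 h2; split => //.
    rewrite [X in `|X|](_ : _ = (X k om * c k + (X j om * c j + \sum_(i <- S) X i om * c i) - w)
       - (X j om - z n) * c j); last by ring.
    apply: le_trans (ler_normB _ _) _; apply: lerD => //.
    by rewrite normrM ler_wpM2r //; exact: zJ.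
apply: (@le_trans _ _ (\sum_(n <oo) P ((cylinder X F A `&` Ev) `&` (X j @^-1` J n)))%E).
  apply: measure_sigma_subadditive.
  - by move=> n; apply: measurableI; [exact: measurableI|exact: measurable_preimage].
  - exact: measurableI.
  - by rewrite -setI_bigcupr -preimage_bigcup UJ preimage_setT setIT.
apply: (@le_trans _ _ (\sum_(n <oo) C%:E * P (X j @^-1` J n `&` cylinder X F A))%E).
  by apply: lee_nneseries => // n _.
rewrite nneseriesZl //.
apply: lee_wpmul2l.
  rewrite lee_fin divr_ge0 ?mulr_ge0 ?addr_ge0 ?mulr_ge0 ?sumr_ge0 ?(ltW eta0) //.
  exact: ltW.
(* The slices of the cylinder by the disjoint cells add up to at most the whole cylinder. *)
rewrite -measure_semi_bigcup.
- apply: le_measure; rewrite ?inE //; last by move=> om [n _ []].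
  by apply: bigcup_measurable => n _; apply: measurableI => //; exact: measurable_preimage.
- by move=> n; apply: measurableI => //; exact: measurable_preimage.
- apply/trivIsetP => m n _ _ mn; apply/seteqP; split => // om [[Jm _] [Jn _]].
  have /trivIsetP/(_ m n I I mn) := tJ.
  by move=> /seteqP[/(_ (X j om))] h _; apply: h.
- by apply: bigcup_measurable => n _; apply: measurableI => //; exact: measurable_preimage.
Qed.

Lemma anticoncentration (X : nat -> Omega -> R) (a : R) (c : nat -> R)
    (N k : nat) (r : R) :
  (forall n, measurable_fun setT (X n)) -> mutually_independent P X ->
  0 < a -> uniform_on_sym P (X k) (a ^+ k) -> c k != 0 -> 0 < r -> (k < N)%N ->
  (P [set om | (`|\sum_(0 <= m < N) X m om * c m| <= r)%R] <=
   (2 * r / (`|c k| * a ^+ k))%:E)%E.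
Proof.
move=> mX indep a0 unif ck0 r0 kN.
pose S := rem k (index_iota 0 N).
have kI : k \in index_iota 0 N by rewrite mem_index_iota.
have S0 : 0 <= \sum_(j <- S) `|c j| by rewrite sumr_ge0.
(* With this mesh the total freezing error is at most [r], whence the factor 2. *)
pose eta := r / (1 + \sum_(j <- S) `|c j|).
have eta0 : 0 < eta by rewrite divr_gt0 // ltr_pwDl.
have uS : uniq (k :: S ++ [::]).
  by rewrite cats0 -(perm_uniq (perm_to_rem kI)) iota_uniq.
have := anticoncentration_cylinder mX indep a0 unif ck0 eta0 (A := fun=> setT)
  (r := r) 0 uS (fun i _ => measurableT) (ltW r0); rewrite /cylinder.
rewrite (_ : \bigcap_(i in [set i | i \in [::]]) _ = setT); last first.
  by apply/seteqP; split => // om _ i.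
rewrite setTI probability_setT mule1.
rewrite (_ : [set om | `|_ + _ - 0| <= r] =
  [set om | `|\sum_(0 <= m < N) X m om * c m| <= r]); last first.
  apply/seteqP; split => om /=; rewrite subr0 (perm_big _ (perm_to_rem kI)) big_cons //.
move=> /le_trans; apply; rewrite lee_fin ler_wpM2r //.
  by rewrite invr_ge0 mulr_ge0 // exprn_ge0 // ltW.
rewrite mulr_natl mulr2n lerD2l /eta mulrAC ler_pdivrMr ?ltr_pwDl //.
by rewrite ler_wpM2l ?(ltW r0) // lerDr.
Qed.

End AntiConcentration.

(** * Close pairs of points of the graph *)

Section ProductMeasure.
Context d1 d2 (T1 : measurableType d1) (T2 : measurableType d2) (R : realType)
  (m1 : {sigma_finite_measure set T1 -> \bar R})
  (m2 : {sigma_finite_measure set T2 -> \bar R}).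

(** A named copy of the product measure that carries a sigma-finite structure, so that it can itself
    be a factor in the product over [Omega * R * R]. *)
Definition prodm : set (T1 * T2) -> \bar R := (m1 \x m2)%E.

HB.instance Definition _ := Measure.copy prodm (m1 \x m2)%E.

Lemma prodm_sigma_finite : sigma_finite setT prodm.
Proof.
have /sigma_finiteP[F [TF ndF Foo]] := sigma_finiteT m1.
have /sigma_finiteP[G [TG ndG Goo]] := sigma_finiteT m2.
exists (fun n => F n `*` G n).
  apply/seteqP; split => // -[x y] _.
  have [n _ Fx] : (\bigcup_n F n) x by rewrite -TF.
  have [k _ Gy] : (\bigcup_n G n) y by rewrite -TG.
  exists (maxn n k) => //; split => /=.
    by apply: (subsetPset _ _ (ndF _ _ (leq_maxl n k))).
  by apply: (subsetPset _ _ (ndG _ _ (leq_maxr n k))).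
move=> k; have [mF Fk] := Foo k; have [mG Gk] := Goo k.
split; first exact: measurableX.
by rewrite /prodm product_measure1E // lte_mul_pinfty // ge0_fin_numE.
Qed.

HB.instance Definition _ := Measure_isSigmaFinite.Build _ _ _ prodm
  prodm_sigma_finite.

Lemma prodm_xsection (A : set (T1 * T2)) :
  prodm A = (\int[m1]_x m2 (xsection A x))%E.
Proof. by []. Qed.

Lemma prodm_ysection (A : set (T1 * T2)) : measurable A ->
  prodm A = (\int[m2]_y m1 (ysection A y))%E.
Proof.
move=> mA; rewrite /prodm (product_measure_unique (m' := (m1 \x^ m2)%E)) //.
by move=> B C mB mC; exact: product_measure2E.
Qed.

End ProductMeasure.

(** Writing u = u^t u^(1-t) allows each factor its own bound; it combines the lengths O(r) and
    O(lam^j) below. *)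
Lemma powR_interpolation (R : realType) (u A B t : R) : 0 <= u -> u <= A ->
  u <= B -> 0 < t < 1 -> u <= A `^ t * B `^ (1 - t).
Proof.
move=> u0 uA uB /andP[t0 t1].
have -> : u = u `^ t * u `^ (1 - t).
  rewrite -powRD; last by apply/implyP; rewrite addrCA subrr addr0 oner_eq0.
  by rewrite addrCA subrr addr0 powRr1.
have B0 : 0 <= B by exact: le_trans uB.
have A0 : 0 <= A by exact: le_trans uA.
by apply: ler_pM; rewrite ?powR_ge0 // ge0_ler_powR ?nnegrE ?subr_ge0 ?(ltW t0) ?(ltW t1).
Qed.

Section SectionEstimate.
Context (R : realType) (d : measure_display) (Omega : measurableType d)
  (P : probability Omega R).

Definition rsum (X : nat -> Omega -> R) (b_ theta : nat -> R) (g : R -> R)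
    (N : nat) (om : Omega) (x : R) : R :=
  \sum_(0 <= m < N) X m om * g (b_ m * x + theta m).

Lemma measurable_affine_comp (g : R -> R) (b th : R) d' (Z : measurableType d')
    (h : Z -> R) : continuous g -> measurable_fun setT h ->
  measurable_fun setT (fun z => g (b * h z + th)).
Proof.
move=> gc mh.
apply: measurableT_comp; first exact: continuous_measurable_fun.
apply: measurable_funD => //.
exact: measurable_funM.
Qed.

Lemma measurable_rsum (X : nat -> Omega -> R) (b_ theta : nat -> R) (g : R -> R)
    (N : nat) d' (Z : measurableType d') (f : Z -> Omega) (h : Z -> R) :
  (forall n, measurable_fun setT (X n)) -> continuous g ->
  measurable_fun setT f -> measurable_fun setT h ->
  measurable_fun setT (fun z => rsum X b_ theta g N (f z) (h z)).
Proof.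
move=> mX gc mf mh; apply: measurable_sum => m.
apply: measurable_funM; first exact: measurableT_comp.
exact: measurable_affine_comp.
Qed.

(** The point [y] is fixed and the other point varies. The factor 3 leaves room for an increment of
    [r] of the full series and two truncation errors of at most [r]. *)
Definition close_pairs (X : nat -> Omega -> R) (b_ theta : nat -> R)
    (g : R -> R) (T : R) (N : nat) (y r : R) : set (Omega * R) :=
  [set z | [/\ 0 <= z.2 <= T, `|z.2 - y| <= r &
     `|rsum X b_ theta g N z.1 z.2 - rsum X b_ theta g N z.1 y| <= 3 * r]].

Lemma measurable_and3 d' (Z : measurableType d') (A B C : Z -> Prop) :
  measurable [set z | A z] -> measurable [set z | B z] ->
  measurable [set z | C z] -> measurable [set z | [/\ A z, B z & C z]].
Proof.
move=> mA mB mC.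
rewrite (_ : [set z | _] = [set z | A z] `&` ([set z | B z] `&` [set z | C z])).
  by apply: measurableI => //; exact: measurableI.
by apply/seteqP; split => z /=; [case|case=> ? []].
Qed.

Lemma measurable_ge0_le d' (Z : measurableType d') (f : Z -> R) (T : R) :
  measurable_fun setT f -> measurable [set z | 0 <= f z <= T].
Proof.
move=> mf; rewrite -[X in measurable X]setTI.
rewrite (_ : [set z | _] = f @^-1` `[0, T]%classic).
  by apply: mf.
by apply/seteqP; split => x /=; rewrite in_itv.
Qed.

Lemma measurable_close_pairs (X : nat -> Omega -> R) (b_ theta : nat -> R)
    (g : R -> R) (T : R) (N : nat) (y r : R) :
  (forall n, measurable_fun setT (X n)) -> continuous g ->
  measurable (close_pairs X b_ theta g T N y r).
Proof.
move=> mX gc; apply: measurable_and3.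
- exact: measurable_ge0_le.
- by apply: measurable_norm_le; exact: measurable_funB.
- apply: measurable_norm_le; apply: measurable_funB;
    exact: measurable_rsum.
Qed.

(* Integrate over the first scale k at which the k-th increment exceeds delta:
   the probability is O(r / a^k) on a set of length O(min(r, lam^k)). *)
Lemma close_pairs_measure (X : nat -> Omega -> R) (b_ theta : nat -> R)
    (g : R -> R) (T a lam t delta C : R) :
  (forall n, measurable_fun setT (X n)) -> mutually_independent P X ->
  (forall n, uniform_on_sym P (X n) (a ^+ n)) -> continuous g ->
  0 < a -> 0 < lam -> 0 < t < 1 -> lam `^ (1 - t) < a -> 0 < delta -> 0 < C ->
  (forall w j (E : set R), measurable E ->
    E `<=` [set x | 0 <= x <= T /\ forall m, (m < j)%N ->
              `|g (b_ m * x + theta m) - w m| <= delta] ->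
    (lebesgue_measure E <= (C * lam ^+ j)%:E)%E) ->
  exists2 C2, 0 < C2 & forall N y r, 0 < r ->
    (prodm P (@lebesgue_measure R) (close_pairs X b_ theta g T N y r) <=
      (C2 * (r `^ (1 + t) + lam ^+ N))%:E)%E.
Proof.
move=> mX indep unif gc a0 lam0 /andP[t0 t1] lama delta0 C0 bad.
pose mu := lam `^ (1 - t) / a.
have mu0 : 0 < mu by rewrite divr_gt0 // powR_gt0.
have mu1 : mu < 1 by rewrite ltr_pdivrMr // mul1r.
(* The j-th term of the sum over first scales will be C1 r^(1+t) mu^j: a probability 6 r / (delta
   a^j) times an interpolated length. *)
pose C1 := 6 / delta * 2 `^ t * C `^ (1 - t).
have C10 : 0 < C1 by rewrite !mulr_gt0 ?powR_gt0 ?invr_gt0.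
exists (C1 / (1 - mu) + C); first by rewrite addr_gt0 // divr_gt0 // subr_gt0.
move=> N y r r0.
pose c x m := g (b_ m * x + theta m) - g (b_ m * y + theta m).
pose E j : set R := [set x | [/\ 0 <= x <= T, `|x - y| <= r &
  forall m, (m < j)%N -> `|c x m| <= delta]].
have mE j : measurable (E j).
  apply: measurable_and3.
  - exact: measurable_ge0_le.
  - by apply: measurable_norm_le; exact: measurable_funB.
  rewrite (_ : [set z | _] = \bigcap_(m in `I_j) [set x | `|c x m| <= delta]).
    apply: fin_bigcap_measurable; first exact: finite_II.
    move=> m _; apply: measurable_norm_le; apply: measurable_funB => //.
    exact: (@measurable_affine_comp g (b_ m) (theta m) _ _ id gc).
  by apply/seteqP; split.
have lE1 j : (lebesgue_measure (E j) <= (2 * r)%:E)%E.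
  have cov : covered (E j) 1 (2 * r).
    exists [:: y - r]; split => // x [_ + _]; rewrite ler_norml => /andP[? ?].
    by exists (y - r); rewrite ?inE //; apply/andP; split; lra.
  have := covered_measure _ (mE j) cov; rewrite mul1r; apply.
  by rewrite mulr_ge0 // ltW.
have lE2 j : (lebesgue_measure (E j) <= (C * lam ^+ j)%:E)%E.
  by apply: (bad (fun m => g (b_ m * y + theta m))) => // x [? _ ?].
have lE j : (lebesgue_measure (E j) <=
    ((2 * r) `^ t * (C * lam ^+ j) `^ (1 - t))%:E)%E.
  have fin : lebesgue_measure (E j) \is a fin_num.
    by rewrite ge0_fin_numE // (le_lt_trans (lE1 j)) // ltry.
  rewrite -(fineK fin) lee_fin; apply: powR_interpolation.
  - exact: fine_ge0.
  - by rewrite -lee_fin fineK.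
  - by rewrite -lee_fin fineK.
  - by rewrite t0.
pose k j := 6 * r / (delta * a ^+ j).
have k0 j : 0 <= k j by rewrite divr_ge0 ?mulr_ge0 ?exprn_ge0 ?(ltW r0) // ltW.
(* A point whose first large increment occurs at scale j < N lies in [E j] and is charged [k j]; a
   point with no large increment before [N] lies in [E N] and is charged 1. The sets [E j] are
   nested, and the overlap only enlarges this majorant. *)
pose h x := (\sum_(j < N) ((k j)%:E * (\1_(E j) x)%:E) + (\1_(E N) x)%:E)%E.
have h0 x : (0 <= \sum_(j < N) ((k j)%:E * (\1_(E j) x)%:E))%E.
  by apply: sume_ge0 => j _; rewrite mule_ge0 ?lee_fin.
have mS := measurable_close_pairs b_ theta T N y r mX gc.
have pointwise x : (P (ysection (close_pairs X b_ theta g T N y r) x) <= h x)%E.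
  have [xr|xr] := pselect (0 <= x <= T /\ `|x - y| <= r); last first.
    rewrite (_ : ysection _ _ = set0) ?measure0.
      by rewrite adde_ge0 // lee_fin.
    apply/seteqP; split => // om; rewrite /ysection /= inE => -[? ? _].
    by apply: xr.
  have [ENx|ENx] := pselect (E N x).
    apply: (@le_trans _ _ 1%E).
      by apply: probability_le1; exact: measurable_ysection.
    by rewrite /h indicE mem_set // leeDr.
  have exm : exists m, (m < N)%N && (delta < `|c x m|).
    apply: contrapT => H; apply: ENx; case: xr => ? ?; split => // m mN.
    rewrite leNgt; apply/negP => dm; apply: H; exists m; by rewrite mN.
  have [k1 /andP[k1N dk1] k1min] := ex_minnP exm.
  have Ek1 : E k1 x.
    case: xr => ? ?; split => // i ik1; rewrite leNgt; apply/negP => di.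
    by have := k1min i; rewrite (ltn_trans ik1 k1N) di leqNgt ik1 => /(_ isT).
  have ck0 : c x k1 != 0.
    by rewrite -normr_gt0; exact: lt_trans dk1.
  apply: (@le_trans _ _ (k k1)%:E); last first.
    rewrite /h (bigD1 (Ordinal k1N)) //= indicE mem_set // mule1 -addeA leeDl //.
    by rewrite adde_ge0 ?lee_fin // sume_ge0 // => j _; rewrite mule_ge0 ?lee_fin.
  have r30 : 0 < 3 * r by rewrite mulr_gt0.
  have -> : ysection (close_pairs X b_ theta g T N y r) x =
      [set om | `|\sum_(0 <= m < N) X m om * c x m| <= 3 * r].
    apply/seteqP; split => om; rewrite /ysection /= ?inE /close_pairs /rsum /=.
      move=> [_ _]; rewrite -sumrB; congr (`|_| <= _).
      by apply: eq_bigr => m' _; rewrite mulrBr.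
    case: xr => ? ? H; split => //; move: H; rewrite -sumrB; congr (`|_| <= _).
    by apply: eq_bigr => m' _; rewrite mulrBr.
  apply: le_trans (anticoncentration mX indep a0 (unif k1) ck0 r30 k1N) _.
  rewrite lee_fin /k mulrA (_ : 2 * 3 = 6 :> R); last by ring.
  rewrite ler_wpM2l ?mulr_ge0 ?(ltW r0) // lef_pV2 ?posrE ?mulr_gt0 ?exprn_gt0 //.
    by rewrite ler_wpM2r ?exprn_ge0 // ltW.
  by rewrite normr_gt0.
rewrite prodm_ysection //.
have mterm j : measurable_fun setT (fun x : R => (k j)%:E * (\1_(E j) x)%:E)%E.
  apply: measurable_funeM; apply/measurable_EFinP; exact: measurable_indic.
have msum : measurable_fun setT
    (fun x : R => \sum_(j < N) ((k j)%:E * (\1_(E j) x)%:E))%E.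
  by apply: emeasurable_sum => j; exact: mterm.
have mind : measurable_fun setT (fun x : R => (\1_(E N) x)%:E : \bar R).
  by apply: measurableT_comp => //; exact: measurable_indic.
apply: (@le_trans _ _ (\int[lebesgue_measure]_x h x)%E).
  apply: ge0_le_integral => //.
  - exact: (measurable_fun_ysection P mS).
  - exact: emeasurable_funD.
  - by move=> x _; exact: pointwise.
rewrite /h ge0_integralD //.
rewrite [X in (X + _ <= _)%E](@ge0_integral_sum _ _ _ lebesgue_measure setT measurableT
  'I_N (fun j x => (k j)%:E * (\1_(E j) x)%:E)%E) //; last 2 first.
- by move=> j; exact: mterm.
- by move=> j x _; rewrite mule_ge0 ?lee_fin.
rewrite integral_indic ?setIT //; last exact: mE.
apply: (@le_trans _ _ (\sum_(j < N) (C1 * r `^ (1 + t) * mu ^+ j)%:E +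
    (C * lam ^+ N)%:E)%E).
  apply: leeD; last exact: lE2.
  apply: lee_sum => j _.
  rewrite ge0_integralZl_EFin //; last first.
    by apply: measurableT_comp => //; apply: measurable_indic; exact: mE.
  rewrite integral_indic ?setIT //; last exact: mE.
  apply: le_trans (lee_wpmul2l _ (lE j)) _; first by rewrite lee_fin.
  rewrite -EFinM lee_fin le_eqVlt; apply/orP; left; apply/eqP.
  rewrite /k /C1 /mu !powRM ?exprn_ge0 ?(ltW r0) ?(ltW C0) ?(ltW lam0) //.
  have -> : (lam ^+ j) `^ (1 - t) = (lam `^ (1 - t)) ^+ j.
    rewrite -!powR_mulrn ?powR_ge0 ?(ltW lam0) //.
    by rewrite -!powRrM mulrC.
  have -> : r `^ (1 + t) = r * r `^ t.
    by rewrite powRD ?powRr1 ?(ltW r0) //; apply/implyP => _; rewrite gt_eqF.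
  rewrite [in RHS]exprMn exprVn.
  by field; rewrite gt_eqF ?exprn_gt0 // gt_eqF.
rewrite sumEFin -EFinD lee_fin -mulr_sumr.
apply: (@le_trans _ _ (C1 * r `^ (1 + t) * (1 / (1 - mu)) + C * lam ^+ N)).
  rewrite lerD2r; apply: ler_wpM2l.
    by apply: mulr_ge0; [exact: ltW|exact: powR_ge0].
  have := @geometric_le_lim R N 1 mu ler01 mu0.
  rewrite ger0_norm ?(ltW mu0) // => /(_ mu1).
  rewrite /series /= big_mkord => H; apply: (le_trans _ H).
  by rewrite le_eqVlt; apply/orP; left; apply/eqP; apply: eq_bigr => i _; rewrite mul1r.
have C1mu : 0 <= C1 / (1 - mu) by rewrite divr_ge0 ?subr_ge0 // ltW.
rewrite mulrDr; apply: lerD.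
  by rewrite mul1r [leLHS]mulrAC ler_wpM2r ?powR_ge0 // lerDl ltW.
by rewrite ler_wpM2r ?exprn_ge0 ?(ltW lam0) // lerDr.
Qed.

End SectionEstimate.

(** * Mass distribution *)

Lemma dist2_ge (R : realType) (p q : R * R) :
  `|p.1 - q.1| <= dist2 p q /\ `|p.2 - q.2| <= dist2 p q.
Proof.
rewrite /dist2 -!sqrtr_sqr; split; apply: ler_wsqrtr.
  by rewrite lerDl sqr_ge0.
by rewrite lerDr sqr_ge0.
Qed.

Lemma dyadic_scale (R : realType) (x : R) (n0 : nat) : 0 < x -> x <= 2^-1 ^+ n0 ->
  exists n, [/\ (n0 <= n)%N, x <= 2^-1 ^+ n & 2^-1 ^+ n.+1 < x].
Proof.
move=> x0 xn0.
have h1 : `|2^-1 : R| < 1 by rewrite ger0_norm //; lra.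
have ex : exists n, (n0 <= n)%N && ((2^-1 : R) ^+ n.+1 < x).
  have H : \forall n \near \oo, (n0 <= n)%N && ((2^-1 : R) ^+ n.+1 < x).
    near=> n; apply/andP; split; first by near: n; exact: nbhs_infty_ge.
    have : geometric 1 (2^-1 : R) n < x.
      by near: n; apply: (cvgr_lt _ (cvg_geometric 1 h1)).
    rewrite /= mul1r => /(le_lt_trans _); apply.
    by rewrite exprS ler_piMl ?exprn_ge0 //; lra.
  by have [n] := filter_ex H; exists n.
have [n /andP[nn0 nx] nmin] := ex_minnP ex.
exists n; split => //.
(* For the least [n], either [n = n0] and the hypothesis bounds [x], or the predecessor of [n] fails
   the strict inequality. *)
have [<-//|n0n] := eqVneq n0 n.
have {}n0n : (n0 < n)%N by rewrite ltn_neqAle n0n.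
case: n nn0 nx nmin n0n => // n _ _ nmin n0n.
rewrite leNgt; apply/negP => xn.
by have := nmin n; rewrite -ltnS n0n xn ltnn => /(_ isT).
Unshelve. all: by end_near.
Qed.

(** A covering set that meets the graph above a good [x] has its abscissas in some [L n x], with
    2^-n less than twice its diameter bound, hence of measure at most 2^s d_i^s. As the bad points
    fill at most half of [[0, T]], the cover costs at least (T / 2) / 2^s. *)
Lemma mass_distribution (R : realType) (F : R -> R) (T s : R)
    (L : nat -> R -> set R) (B : nat -> set R) :
  0 < T -> 0 < s -> (forall n x, measurable (L n x)) ->
  (forall n, measurable (B n)) ->
  (forall n x y, 0 <= x <= T -> 0 <= y <= T -> `|x - y| <= 2^-1 ^+ n ->
     `|F x - F y| <= 2^-1 ^+ n -> L n x y) ->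
  (forall n x, 0 <= x <= T -> ~ B n x ->
     (lebesgue_measure (L n x) <= ((2^-1 ^+ n) `^ s)%:E)%E) ->
  (\sum_(n <oo) lebesgue_measure (B n) < +oo)%E ->
  content_lower_bound (graph_on F 0 T) s.
Proof.
move=> T0 s0 mL mB FL LB sumB.
have [n0 Hn0] : exists n0, (\sum_(n0 <= n <oo) lebesgue_measure (B n) <= (T / 2)%:E)%E.
  have /fine_cvgP[fin cvT] := nneseries_tail_cvg sumB (fun _ _ => measure_ge0 _ _).
  have T20 : 0 < T / 2 by rewrite divr_gt0.
  have H : \forall n \near \oo, (\sum_(n <= k <oo) lebesgue_measure (B k) <= (T / 2)%:E)%E.
    near=> n.
    have finn : (\sum_(n <= k <oo) lebesgue_measure (B k) \is a fin_num)%E.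
      by near: n; exact: fin.
    rewrite -(fineK finn) lee_fin; apply: ltW.
    by near: n; exact: (cvgr_lt _ cvT _ T20).
  by have [n] := filter_ex H; exists n.
exists (T / 2 / 2 `^ s), (2^-1 ^+ n0); split; rewrite ?divr_gt0 ?powR_gt0 ?exprn_gt0 //.
apply: le_ereal_inf_tmp => _ [U [d [EU dd dU ->]]].
pose BB := \bigcup_(n in ~` `I_n0) B n.
(* [V i] is a measurable substitute for the set of good abscissas of the graph inside [U i]. *)
have /choice[V HV] : forall i, exists V : set R, [/\ measurable V,
    forall y, 0 <= y <= T -> U i (y, F y) -> BB y \/ V y &
    (lebesgue_measure V <= (2 `^ s * d i `^ s)%:E)%E].
  move=> i; have [di0 din0] := dd i.
  have [[x [x0 xU xB]]|nx] := pselect (exists x, [/\ 0 <= x <= T,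
      U i (x, F x) & ~ BB x]); last first.
    exists set0; split; rewrite ?measure0 ?lee_fin ?mulr_ge0 ?powR_ge0 //.
    move=> y y0 yU; left; apply: contrapT => yB; apply: nx; by exists y.
  have close y : U i (y, F y) -> `|x - y| <= d i /\ `|F x - F y| <= d i.
    move=> yU; have [h1 h2] := dist2_ge (x, F x) (y, F y).
    by have h3 := dU i _ _ xU yU; split; [exact: le_trans h3|exact: le_trans h3].
  (* A bound of 0 has no dyadic scale, but then [U i] contains at most one point and a singleton
     will do. *)
  have [di|dn0] := eqVneq (d i) 0.
    exists [set x]; split => //; last first.
      by rewrite lebesgue_measure_set1 lee_fin mulr_ge0 ?powR_ge0.
    move=> y _ /close[]; rewrite di normr_le0 subr_eq0 => /eqP -> _; by right.
  have dgt0 : 0 < d i by rewrite lt_def dn0.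
  have [n [nn0 dn nd]] := dyadic_scale dgt0 din0.
  exists (L n x); split => //.
    move=> y y0 /close[h1 h2]; right; apply: FL => //.
      exact: le_trans dn.
    exact: le_trans dn.
  apply: le_trans (LB _ _ x0 _) _.
    by move=> xBn; apply: xB; exists n => //=; apply/negP; rewrite -leqNgt.
  rewrite lee_fin -powRM // ge0_ler_powR ?nnegrE ?exprn_ge0 ?mulr_ge0 ?(ltW s0) //.
  by move: nd; rewrite exprS; lra.
have mBB : measurable BB by exact: bigcup_measurable.
have mV : measurable (\bigcup_i V i).
  by apply: bigcup_measurable => i _; have [] := HV i.
have cov : `[0, T]%classic `<=` BB `|` \bigcup_i V i.
  move=> y /=; rewrite in_itv /= => y0.
  have [i _ Ui] := EU (y, F y) (conj y0 erefl).
  by have [_ /(_ y y0 Ui)[|] ? _] := HV i; [left|right; exists i].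
have lT : lebesgue_measure `[0, T]%classic = T%:E :> \bar R.
  by rewrite lebesgue_measure_itv /= lte_fin T0 -EFinD subr0.
have lBB : (lebesgue_measure BB <= (T / 2)%:E)%E.
  by apply: le_trans Hn0; exact: measure_sigma_subadditive_tail.
have lV : (lebesgue_measure (\bigcup_i V i) <=
    (2 `^ s)%:E * \sum_(i <oo) (d i `^ s)%:E)%E.
  rewrite -nneseriesZl; last by move=> i _; rewrite lee_fin powR_ge0.
  apply: (@le_trans _ _ (\sum_(i <oo) lebesgue_measure (V i))%E).
    by apply: measure_sigma_subadditive => // i; have [] := HV i.
  by apply: lee_nneseries => // i _; rewrite -EFinM; have [] := HV i.
have key : (T%:E <= (T / 2)%:E + (2 `^ s)%:E * \sum_(i <oo) (d i `^ s)%:E)%E.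
  rewrite -lT; apply: (@le_trans _ _ (lebesgue_measure (BB `|` \bigcup_i V i))).
    by apply: le_measure => //; rewrite inE //; exact: measurableU.
  by apply: le_trans (measureU2 lebesgue_measure mBB mV) _; exact: leeD.
have S0 : (0 <= \sum_(i <oo) (d i `^ s)%:E)%E.
  by apply: nneseries_ge0 => i _ _; rewrite lee_fin powR_ge0.
move: key S0; case: (\sum_(i <oo) (d i `^ s)%:E)%E => [x|_ _|_]; rewrite ?leey //.
rewrite -EFinM -EFinD !lee_fin => key _.
rewrite ler_pdivrMr ?powR_gt0 //; lra.
Unshelve. all: by end_near.
Qed.

(** * Almost sure statements about sections *)

(** A Borel-Cantelli argument: by Tonelli the sum of the section measures has a finite integral, so
    it is finite almost everywhere. *)
Lemma ae_summable_xsections d1 d2 (T1 : measurableType d1) (T2 : measurableType d2)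
    (R : realType) (m1 : {sigma_finite_measure set T1 -> \bar R})
    (m2 : {sigma_finite_measure set T2 -> \bar R}) (A : nat -> set (T1 * T2)) :
  (forall n, measurable (A n)) -> (\sum_(n <oo) prodm m1 m2 (A n) < +oo)%E ->
  {ae m1, forall x, (\sum_(n <oo) m2 (xsection (A n) x) < +oo)%E}.
Proof.
move=> mA sumA.
pose h x := (\sum_(n <oo) m2 (xsection (A n) x))%E.
have h0 x : (0 <= h x)%E by apply: nneseries_ge0.
have mAn n : measurable_fun setT (fun x => m2 (xsection (A n) x)).
  exact: (measurable_fun_xsection m2 (mA n)).
have mh : measurable_fun setT h by exact: ge0_emeasurable_sum.
have int : m1.-integrable setT h.
  apply/integrableP; split => //.
  under eq_integral do rewrite gee0_abs //.
  by rewrite integral_nneseries.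
have := integrable_ae measurableT int.
apply: filterS => x /(_ I).
by rewrite ge0_fin_numE.
Qed.

(** Markov's inequality for the measure of the section, whose integral is the measure of [A]. *)
Lemma markov_xsection d1 d2 (T1 : measurableType d1) (T2 : measurableType d2)
    (R : realType) (m1 : {sigma_finite_measure set T1 -> \bar R})
    (m2 : {sigma_finite_measure set T2 -> \bar R}) (A : set (T1 * T2)) (c K : R) :
  measurable A -> 0 < c -> (prodm m1 m2 A <= K%:E)%E ->
  measurable [set x | (c%:E < m2 (xsection A x))%E] /\
  (m1 [set x | (c%:E < m2 (xsection A x))%E] <= (K / c)%:E)%E.
Proof.
move=> mA c0 AK.
have mq : measurable_fun setT (fun x => m2 (xsection A x)).
  exact: (measurable_fun_xsection m2 mA).
have mB : measurable [set x | (c%:E < m2 (xsection A x))%E].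
  rewrite -[X in measurable X]setTI.
  exact: emeasurable_fun_o_infty.
split => //.
have : (c%:E * m1 [set x | (c%:E < m2 (xsection A x))%E] <= K%:E)%E.
  apply: le_trans AK; rewrite prodm_xsection.
  rewrite -[X in m1 X]setIT -integral_indic // -ge0_integralZl_EFin //; last 2 first.
  - by apply: measurableT_comp => //; exact: measurable_indic.
  - exact: ltW.
  apply: ge0_le_integral => //.
  - by move=> x _; rewrite mule_ge0 ?lee_fin // ltW.
  - apply: measurable_funeM; apply: measurableT_comp => //; exact: measurable_indic.
  move=> x _; rewrite indicE; case: (boolP (x \in _)) => [|_].
    by rewrite inE /= mule1 => /ltW.
  by rewrite mule0.
by rewrite muleC -lee_pdivlMr // -EFinM.
Qed.

Lemma geometric_nneseries_lty (R : realType) (K q : R) : 0 <= K -> 0 < q < 1 ->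
  (\sum_(n <oo) (K * q ^+ n)%:E < +oo)%E.
Proof.
move=> K0 /andP[q0 q1]; apply: (@le_lt_trans _ _ (K / (1 - q))%:E); last exact: ltry.
apply: lime_le.
  by apply: is_cvg_nneseries => n _ _; rewrite lee_fin mulr_ge0 // exprn_ge0 // ltW.
apply: nearW => n; rewrite sumEFin lee_fin.
by apply: (@geometric_le_lim R n K q) => //; rewrite ger0_norm // ltW.
Qed.

Lemma uniform_ae_bound (R : realType) (d : measure_display)
    (Omega : measurableType d) (P : probability Omega R) (X : Omega -> R) (c : R) :
  measurable_fun setT X -> uniform_on_sym P X c ->
  {ae P, forall om, `|X om| <= c}.
Proof.
move=> mX unif.
have mA : measurable [set x : R | ~ `|x| <= c].
  rewrite (_ : [set x | _] = ~` [set x : R | `|x| <= c]) //.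
  by apply: measurableC; apply: measurable_norm_le.
exists (X @^-1` [set x | ~ `|x| <= c]); split => //.
  exact: measurable_preimage.
rewrite unif // (_ : _ `&` _ = set0) ?measure0 ?mul0e //.
apply/seteqP; split => // x [/= xc]; rewrite in_itv /= => /andP[h1 h2].
by apply: xc; rewrite ler_norml !ltW.
Qed.

(** The close triples (om, x, y) at scale r have measure O(r^(1+t)), so by Markov the pairs (om, x)
    with more than r^s close y have measure O(r^(1+t-s)), summable over dyadic r. For almost every
    om the sections then meet the hypotheses of [mass_distribution]. *)
Lemma content_lower_bound_ae (R : realType) (d : measure_display)
    (Omega : measurableType d) (P : probability Omega R)
    (X : nat -> Omega -> R) (b_ theta : nat -> R) (g : R -> R)
    (T a lam t delta C M s : R) :
  (forall n, measurable_fun setT (X n)) -> mutually_independent P X ->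
  (forall n, uniform_on_sym P (X n) (a ^+ n)) -> continuous g ->
  0 < T -> 0 < a < 1 -> 0 < lam < 1 -> 0 < t < 1 -> lam `^ (1 - t) < a ->
  0 < delta -> 0 < C ->
  (forall w j (E : set R), measurable E ->
    E `<=` [set x | 0 <= x <= T /\ forall m, (m < j)%N ->
              `|g (b_ m * x + theta m) - w m| <= delta] ->
    (lebesgue_measure E <= (C * lam ^+ j)%:E)%E) ->
  0 <= M -> (forall x, `|g x| <= M) -> 0 < s < 1 + t ->
  {ae P, forall om, (forall n, `|X n om| <= a ^+ n) ->
    content_lower_bound (graph_on (fun x =>
      limn (series (fun n => X n om * g (b_ n * x + theta n)))) 0 T) s}.
Proof.
move=> mX indep unif gc T0 /andP[a0 a1] /andP[lam0 lam1] t01 lama delta0 C0 bad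
  M0 gM /andP[s0 st].
have [C2 C20 HC2] := close_pairs_measure mX indep unif gc a0 lam0 t01 lama
  delta0 C0 bad.
have [t0 t1] : 0 < t /\ t < 1 by apply/andP.
pose r n : R := 2^-1 ^+ n.
have r0 n : 0 < r n by rewrite exprn_gt0.
(* The truncation is late enough for lam^N to be absorbed into r^(1+t), at the price of a factor 2,
   and for the tail of the series to be at most r. *)
have /choice[N HN] : forall n, exists N, lam ^+ N <= r n `^ (1 + t) /\
    M * a ^+ N / (1 - a) <= r n.
  move=> n.
  have hl : `|lam| < 1 by rewrite ger0_norm // ltW.
  have ha : `|a| < 1 by rewrite ger0_norm // ltW.
  have H : \forall N \near \oo, lam ^+ N <= r n `^ (1 + t) /\
      M * a ^+ N / (1 - a) <= r n.
    near=> N; split.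
      have : geometric 1 lam N < r n `^ (1 + t).
        near: N; apply: (cvgr_lt _ (cvg_geometric 1 hl)).
        by rewrite powR_gt0.
      by rewrite /= mul1r => /ltW.
    have : geometric (M / (1 - a)) a N < r n.
      by near: N; apply: (cvgr_lt _ (cvg_geometric (M / (1 - a)) ha)).
    by rewrite /= mulrAC => /ltW.
  by have [N] := filter_ex H; exists N.
pose S n : set (Omega * R * R) := [set z | 0 <= z.2 <= T /\
  close_pairs X b_ theta g T (N n) z.2 (r n) z.1].
have mS n : measurable (S n).
  rewrite (_ : S n = [set z | 0 <= z.2 <= T] `&` [set z | [/\ 0 <= z.1.2 <= T,
     `|z.1.2 - z.2| <= r n & `|rsum X b_ theta g (N n) z.1.1 z.1.2 -
        rsum X b_ theta g (N n) z.1.1 z.2| <= 3 * r n]]) //.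
  have m12 : measurable_fun setT (fun z : Omega * R * R => z.1.2).
    by apply: measurableT_comp.
  have m11 : measurable_fun setT (fun z : Omega * R * R => z.1.1).
    by apply: measurableT_comp.
  apply: measurableI; first exact: measurable_ge0_le.
  apply: measurable_and3.
  - exact: measurable_ge0_le.
  - by apply: measurable_norm_le; exact: measurable_funB.
  - by apply: measurable_norm_le; apply: measurable_funB; exact: measurable_rsum.
pose PL := prodm P (@lebesgue_measure R).
have hS n : (prodm PL (@lebesgue_measure R) (S n) <=
    (2 * C2 * r n `^ (1 + t) * T)%:E)%E.
  rewrite prodm_ysection; last exact: mS.
  pose K := 2 * C2 * r n `^ (1 + t).
  have K0 : 0 <= K by rewrite !mulr_ge0 ?powR_ge0 // ltW.
  have mI : measurable (`[0, T]%classic : set R) by exact: measurable_itv.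
  have mind : measurable_fun setT (fun y : R => (\1_(`[0, T]%classic : set R) y)%:E : \bar R).
    by apply: measurableT_comp => //; apply: measurable_indic.
  apply: (@le_trans _ _ (\int[lebesgue_measure]_y
      (K%:E * (\1_(`[0, T]%classic : set R) y)%:E))%E).
    apply: ge0_le_integral => //.
    - exact: (measurable_fun_ysection PL (mS n)).
    - exact: measurable_funeM.
    move=> y _; rewrite indicE; case: (boolP (y \in _)) => [|yT].
      rewrite inE /= in_itv /= => yT; rewrite mule1.
      have -> : ysection (S n) y = close_pairs X b_ theta g T (N n) y (r n).
        by apply/seteqP; split => z; rewrite /ysection /= inE; [case|].
      apply: le_trans (HC2 (N n) y (r n) (r0 n)) _; rewrite lee_fin /K.
      rewrite (mulrC 2) -mulrA ler_pM2l // mulrDl mul1r lerD2l.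
      by have [] := HN n.
    rewrite (_ : ysection _ _ = set0) ?measure0 ?mule_ge0 ?lee_fin //.
    apply/seteqP; split => // z; rewrite /ysection /= inE => -[yT' _].
    by rewrite notin_setE /= in_itv /= in yT.
  rewrite ge0_integralZl_EFin // integral_indic // setIT.
  have lT : lebesgue_measure `[0, T]%classic = T%:E :> \bar R.
    by rewrite lebesgue_measure_itv /= lte_fin T0 -EFinD subr0.
  by rewrite [X in (_ * X <= _)%E]lT -EFinM.
pose Bad n := [set z | (((r n) `^ s)%:E < lebesgue_measure (xsection (S n) z))%E].
have HBad n : measurable (Bad n) /\
    (PL (Bad n) <= (2 * C2 * r n `^ (1 + t) * T / r n `^ s)%:E)%E.
  apply: (markov_xsection (m1 := PL) (m2 := lebesgue_measure) (mS n)); last exact: hS.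
  exact: powR_gt0.
have mBad n : measurable (Bad n) by have [] := HBad n.
(* The measures of the sets [Bad n] are bounded by a geometric series of this ratio, less than 1
   because [s < 1 + t]. *)
pose q := (2^-1 : R) `^ (1 + t - s).
have q01 : 0 < q < 1.
  rewrite powR_gt0 //=.
  have q1 : (2^-1 : R) `^ (1 + t - s) < 1 `^ (1 + t - s).
    by apply: gt0_ltr_powR; rewrite ?nnegrE //; lra.
  by rewrite /q (lt_le_trans q1) // powR1.
have sumBad : (\sum_(n <oo) PL (Bad n) < +oo)%E.
  apply: (@le_lt_trans _ _ (\sum_(n <oo) (2 * C2 * T * q ^+ n)%:E)%E); last first.
    apply: geometric_nneseries_lty => //.
    by rewrite !mulr_ge0 // ltW.
  apply: lee_nneseries => // n _; have [_ h] := HBad n; apply: le_trans h _.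
  rewrite lee_fin le_eqVlt; apply/orP; left; apply/eqP.
  have -> : q ^+ n = r n `^ (1 + t) / r n `^ s.
    rewrite -powRB; last by apply/implyP => _; rewrite gt_eqF.
    rewrite /q /r -!powR_mulrn ?powR_ge0 //.
    by rewrite -!powRrM mulrC.
  by field; rewrite gt_eqF // powR_gt0.
have := ae_summable_xsections (m1 := P) (m2 := lebesgue_measure) mBad sumBad.
apply: filterS => om sumom Xom.
have tail x N' : `|limn (series (fun n => X n om * g (b_ n * x + theta n))) -
    rsum X b_ theta g N' om x| <= M * a ^+ N' / (1 - a).
  apply: (geometric_series_tail (q := a) M0 _ _).2; first by rewrite a0.
  by move=> n; rewrite normrM mulrC ler_pM.
apply: (@mass_distribution _ _ _ _ (fun n x => xsection (S n) (om, x))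
  (fun n => xsection (Bad n) om)) => //.
- by move=> n x; exact: measurable_xsection.
- by move=> n; exact: measurable_xsection.
- move=> n x y x0 y0 xy Fxy; rewrite /xsection /= inE; split => //; split => //=.
  have [_ Nr] := HN n.
  have := le_trans (tail x (N n)) Nr; have := le_trans (tail y (N n)) Nr.
  move: Fxy; rewrite -/(r n) !ler_norml => /andP[? ?] /andP[? ?] /andP[? ?].
  by apply/andP; split; lra.
- move=> n x _ nB; rewrite leNgt; apply/negP => h; apply: nB.
  by rewrite /xsection /= inE.
Unshelve. all: by end_near.
Qed.

(** * Choice of the growth rates *)

(** As a = b^-al, the choice beta = b^c works for every c strictly between 1 and al / h; the
    midpoint is taken. *)
Lemma powR_gap (R : realType) (a b : R) (al : R) : 0 < a -> 1 < b ->
  ln a = - al * ln b ->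
  forall h, 0 < h < al -> exists2 beta, b < beta & a * beta `^ h < 1.
Proof.
move=> a0 b1 la h /andP[h0 hal].
have b0 : 0 < b by exact: lt_trans b1.
have lb : 0 < ln b by exact: ln_gt0.
pose c := (1 + al / h) / 2.
have hc : h * c = (h + al) / 2 by rewrite /c; field; rewrite gt_eqF.
have c1 : 1 < c.
  have : 1 < al / h by rewrite ltr_pdivlMr ?mul1r.
  by rewrite /c; lra.
exists (b `^ c).
  rewrite -ltr_ln ?posrE ?powR_gt0 // ln_powR; nra.
rewrite -ltr_ln ?posrE ?mulr_gt0 ?powR_gt0 // lnM ?posrE ?powR_gt0 //.
rewrite !ln_powR ln1 la mulrA hc; nra.
Qed.

(** Here lam = b^-c with c the midpoint of al / u and 1. *)
Lemma powR_gap_inv (R : realType) (a b : R) (al : R) : 0 < a -> 1 < b ->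
  ln a = - al * ln b ->
  forall u, 0 < al < u -> exists2 lam, b^-1 < lam < 1 & lam `^ u < a.
Proof.
move=> a0 b1 la u /andP[al0 alu].
have b0 : 0 < b by exact: lt_trans b1.
have lb : 0 < ln b by exact: ln_gt0.
have u0 : 0 < u by exact: lt_trans alu.
pose c := (1 + al / u) / 2.
have uc : u * c = (u + al) / 2 by rewrite /c; field; rewrite gt_eqF.
have auu : 0 < al / u < 1.
  by rewrite divr_gt0 //= ltr_pdivrMr ?mul1r.
have c0 : 0 < c < 1 by rewrite /c; move: auu => /andP[? ?]; apply/andP; split; lra.
move: c0 => /andP[c0 c1].
exists (b `^ (- c)); last first.
  rewrite -ltr_ln ?posrE ?powR_gt0 // !ln_powR la mulrA mulrN uc; nra.
apply/andP; split.
  rewrite -ltr_ln ?posrE ?invr_gt0 ?powR_gt0 // lnV ?posrE // ln_powR; nra.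
rewrite -ltr_ln ?posrE ?powR_gt0 // ln_powR ln1; nra.
Qed.

Theorem theoremA (R : realType) (d : measure_display) (Omega : measurableType d)
  (P : probability Omega R) (a b : R) (a_ : nat -> Omega -> R)
  (b_ : nat -> R) (theta : nat -> R) (g : R -> R) (T : R) :
  0 < a < 1 ->
  (forall n, measurable_fun setT (a_ n)) ->
  mutually_independent P a_ ->
  (forall n, uniform_on_sym P (a_ n) (a ^+ n)) ->
  1 < b -> 1 < a * b ->
  (fun n => b_ n.+1 / b_ n) @ \oo --> b ->
  (* g is C^1 *)
  (forall x, derivable g x 1) -> continuous (derive1 g) ->
  (* g is periodic with (least positive) period T *)
  0 < T -> (forall x, g (x + T) = g x) ->
  (forall T', 0 < T' < T -> ~ (forall x, g (x + T') = g x)) ->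
  (* finitely many critical points in every bounded interval *)
  (forall u v, finite_set [set x | u <= x <= v /\ derive1 g x = 0]) ->
  let f := fun (w : Omega) (x : R) =>
    limn (series (fun n => a_ n w * g (b_ n * x + theta n))) in
  let D := 2 + ln a / ln b in
  {ae P, forall w,
     hausdorff_dim (graph_on (f w) 0 T) = D%:E /\
     box_dim_eq (graph_on (f w) 0 T) D}.
Proof.
move=> a01 mX indep unif b1 ab1 cvb dg g'c T0 gT _ fin f D.
have [a0 a1] : 0 < a /\ a < 1 by apply/andP.
have b0 : 0 < b by exact: lt_trans b1.
have lb : 0 < ln b by exact: ln_gt0.
pose al := - (ln a / ln b).
have DE : D = 2 - al by rewrite /al opprK.
clearbody D.
have la : ln a = - al * ln b by rewrite /al opprK divfK // gt_eqF.
have la0 : ln a < 0 by apply: ln_lt0.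
have lab : 0 < ln a + ln b by rewrite -lnM ?posrE // ln_gt0.
(* [a < 1] gives [0 < al] and [1 < a * b] gives [al < 1], so that [D] lies strictly between 1 and
   2. *)
have al0 : 0 < al by nra.
have al1 : al < 1 by nra.
have gc : continuous g.
  by move=> x; apply: differentiable_continuous; apply/derivable1_diffP.
have [M M0 gM] := periodic_bounded T0 gT gc.
have [L L0 g'L] := periodic_bounded T0 (periodic_derive1 gT) g'c.
have gL := lipschitz_of_derive1 dg g'L.
have upper w : (forall n, `|a_ n w| <= a ^+ n) ->
    forall s, D < s -> count_upper_bound (graph_on (f w) 0 T) s.
  (* An exponent with 2 - s <= h < al is wanted; [al / 2] keeps it positive when [s] is 2 or
     more. *)
  move=> aw s Ds; pose h := Num.max (2 - s) (al / 2).
  have h0 : 0 < h by rewrite lt_max; apply/orP; right; lra.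
  have hal : h < al by rewrite gt_max; apply/andP; split; lra.
  have hs : 2 - s <= h by rewrite le_max lexx.
  have h01 : 0 < h <= 1 by rewrite h0 /=; lra.
  have [|beta bbeta abeta] := powR_gap a0 b1 la (h := h); first by rewrite h0.
  have beta0 : 0 < beta by exact: lt_trans bbeta.
  have [m0 Hm] := lacunary_of_ratio ltr01 b1 bbeta cvb.
  have [|C C0 bC] := geometric_growth_bound (m0 := m0) beta0
      (fun n => normr_ge0 (b_ n)).
    by move=> n /Hm[].
  have gh := holder_of_lipschitz (ltW L0) (ltW M0) h01 gL gM.
  have LM : 0 <= L + 2 * M by rewrite addr_ge0 ?mulr_ge0 // ltW.
  have fh := series_holder theta a01 beta0 (ltW h0) abeta (ltW C0) bC
    aw LM (ltW M0) gh gM.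
  apply: (@holder_graph_count _ _ _ h
    ((L + 2 * M) * C `^ h / (1 - a * beta `^ h)) s) => //.
  - by rewrite divr_ge0 ?mulr_ge0 ?powR_ge0 // subr_ge0 ltW.
  - lra.
  - by move=> x y _ _; exact: fh.
have lower s : 0 < s < D -> {ae P, forall w, (forall n, `|a_ n w| <= a ^+ n) ->
    content_lower_bound (graph_on (f w) 0 T) s}.
  (* The first entry is the midpoint of s - 1 and 1 - al, which gives s - 1 < t < 1 - al; the second
     keeps [t] positive. *)
  move=> /andP[s0 sD]; pose t := Num.max ((s - al) / 2) ((1 - al) / 2).
  have t0 : 0 < t by rewrite lt_max; apply/orP; right; lra.
  have tal : t < 1 - al by rewrite gt_max; apply/andP; split; lra.
  have st : s < 1 + t.
    have : (s - al) / 2 <= t by rewrite le_max lexx.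
    by lra.
  have [|lam lamb lama] := powR_gap_inv a0 b1 la (u := 1 - t).
    by rewrite al0 /=; lra.
  have [delta [C [delta0 C0 bad]]] := bad_set_measure theta T0 dg gT fin b1 cvb lamb.
  have lam01 : 0 < lam < 1.
    by move: lamb => /andP[h ->]; rewrite andbT; apply: lt_trans h; rewrite invr_gt0.
  apply: (content_lower_bound_ae mX indep unif gc T0 a01 lam01 _ lama delta0 C0
    bad (ltW M0) gM).
  - by rewrite t0 /=; lra.
  - by rewrite s0.
have aew : {ae P, forall w n, `|a_ n w| <= a ^+ n}.
  by apply: ae_foralln => n; exact: uniform_ae_bound.
(* Countably many exponents tending to [D] are enough, so the exceptional null sets can be united.
   They are positive because [D > 1]. *)
have aes : {ae P, forall w k, (forall n, `|a_ n w| <= a ^+ n) ->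
    content_lower_bound (graph_on (f w) 0 T) (D - k.+2%:R^-1)}.
  apply: ae_foralln => k; apply: lower.
  have k2 : 0 < (k.+2%:R : R)^-1 by rewrite invr_gt0.
  have k1 : (k.+2%:R : R)^-1 <= 1 by rewrite invf_le1 // ler1n.
  by move: k2 k1; set x := _^-1 => k2 k1; apply/andP; split; lra.
have D0 : 0 < D by lra.
apply: filterS2 aew aes => w aw lw.
have lowerE e : 0 < e -> exists s : R,
    [/\ D - e < s, 0 < s & content_lower_bound (graph_on (f w) 0 T) s].
  move=> e0; pose k := Num.truncn e^-1.
  have k2 : (0 : R) < k.+2%:R by [].
  exists (D - k.+2%:R^-1); split; last exact: lw.
    rewrite ltrD2l ltrN2 invf_plt ?posrE //.
    have eV : 0 <= e^-1 by rewrite invr_ge0 ltW.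
    have /andP[_ h] := truncn_itv eV.
    by apply: lt_trans h _; rewrite ltr_nat.
  have k1 : (k.+2%:R : R)^-1 <= 1 by rewrite invf_le1 // ler1n.
  by move: k1; set x := _^-1 => k1; lra.
split; first exact: hausdorff_dim_of_bounds (upper w aw).
exact: box_dim_of_bounds (upper w aw).
Qed.
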